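(* Let $(\mu,C)$ be a $\mathbb{Z}^n$-periodic lighthouse measure in $\mathbb{R}^n$. If there exist a $d$-dimensional $C^{1+\epsilon}$-submanifold $M\subset\mathbb{R}^n$ and an open set $B\subset\mathbb{R}^n$ with $M\cap B\neq\emptyset$ such that $d\mu|_B=\rho\,d\sigma|_B$ with $\rho>0$ continuous, where $\sigma$ is the $d$-dimensional volume measure on $M$, then $d=n-1$. Moreover, $M$ admits an orientation for which the unit normal $\mathbf{n}$ satisfies $\mathbf{n}(x)\in C$ for all $x\in M\cap B$.
   Context: A cone is a set $C\subset\mathbb{R}^n$ with $x\in C\iff\lambda x\in C$ for all $\lambda\in(0,\infty)$. A proper cone is a closed convex cone with non-empty interior for which there is a direction $\ell\in\mathbb{R}^n$ with $\langle\ell,x\rangle>0$ for all $x\in C\setminus\{0\}$. For a $\mathbb{Z}^n$-periodic Radon measure $m$ on $\mathbb{R}^n$, its Fourier coefficients are $\widehat m(k)=\int_{\mathbb{R}^n/\mathbb{Z}^n}e^{-2\pi i\langle k,x\rangle}dm(x)$ for $k\in\mathbb{Z}^n$, and $\mathrm{supp}(\widehat m)=\{k\in\mathbb{Z}^n\mid\widehat m(k)\neq0\}$. A pair $(\mu,C)$ of a non-negative $\mathbb{Z}^n$-periodic Radon measure $\mu$ on $\mathbb{R}^n$ and a proper cone $C\subset\mathbb{R}^n$ is called a lighthouse (or lighthouse measure) if (1) $\mu$ is supported on a closed set of Lebesgue measure zero, and (2) $\mathrm{supp}(\widehat\mu)\subset\mathbb{Z}^n\cap(-C\cup C)$. For $0<\epsilon<1$,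 a function is of class $C^{1+\epsilon}$ if its derivative exists and is $\epsilon$-Hölder continuous; a $C^{1+\epsilon}$-submanifold is one that is locally, up to rotation, the graph of a $C^{1+\epsilon}$-function. The volume measure $\sigma$ on $M$ is the one induced by the Lebesgue measure (Euclidean structure) of $\mathbb{R}^n$.
   Formalization: The orientation is a continuous unit normal field on M∩B, not on all of M: a connected U-shaped M containing pieces of two parallel lines of the support (B around those pieces) has no global orientation with the normal in C on M∩B. *)

(* Defs.v *)
From HB Require Import structures.
From mathcomp Require Import all_boot all_order all_algebra.
From mathcomp Require Import all_classical all_reals all_analysis.
From mathcomp Require Import lra.
From mathcomp.real_closed Require Import complex.
Import Order.TTheory GRing.Theory Num.Theory.
Import numFieldNormedType.Exports.

Set Implicit Arguments.
Unset Strict Implicit.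
Unset Printing Implicit Defensive.

Local Open Scope classical_set_scope.
Local Open Scope ring_scope.

(** * Borel sets and Lebesgue measure on R^n

    R^n is ['rV[R]_n]. The library topologizes it by the max norm, which
    matters only up to equivalence of norms; lengths and angles below always
    come from [dot]. *)

Notation borel R n := (g_sigma_algebraType (@open 'rV[R]_n)).

Definition cons_rV (R : realType) (d : nat)
    (p : measurableTypeR R * borel R d) : borel R d.+1 :=
  row_mx (p.1%:M : 'rV[R]_1) (p.2 : 'rV[R]_d).

Fixpoint lebesgue_rV (R : realType) (d : nat) : set (borel R d) -> \bar R :=
  match d with
  | 0 => \d_ ((0 : 'rV[R]_0) : borel R 0)
  | d'.+1 => fun A =>
      (product_measure1 (@lebesgue_measure R) (@lebesgue_rV R d')
        (@cons_rV R d' @^-1` A))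
  end.

Section lebesgue_rV_is_measure.
Context {R : realType}.

Lemma open_measurable_borel n (A : set (borel R n)) :
  open (A : set 'rV[R]_n) -> measurable A.
Proof. exact: sub_sigma_algebra. Qed.

Lemma cons_rV_continuous d :
  continuous (fun p : R * 'rV[R]_d => (cons_rV p : 'rV[R]_d.+1)).
Proof.
move=> p; apply/cvg_ballP => e e0; near=> q.
have [b1 b2] : ball p e q by near: q; apply: (@nbhsx_ballx R (R * 'rV[R]_d)%type p e e0).
split=> // i j; rewrite !mxE; case: splitP => k _; last by case: b2.
by rewrite !mxE !ord1 eqxx !mulr1n.
Unshelve. all: by end_near. Qed.

Lemma measurable_cons_rV d : measurable_fun setT (@cons_rV R d).
Proof.
apply: (@measurability _ _ (measurableTypeR R * borel R d)%type (borel R d.+1) setT (@cons_rV R d) (@open 'rV[R]_d.+1)) => // _ [U oU <-].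
rewrite setTI.
have oV : open ((fun p : R * 'rV[R]_d => cons_rV p : 'rV[R]_d.+1) @^-1` U).
  by apply: open_comp => // p _; exact: cons_rV_continuous.
set V := _ @^-1` U in oV *.
pose B (q : rat) (k : nat) : set R := ball (ratr q : R) k.+1%:R^-1.
pose S q k : set 'rV[R]_d := [set v | forall x, B q k x -> V (x, v)].
have -> : V = \bigcup_q \bigcup_k (B q k `*` (S q k)^°).
  apply/seteqP; split=> [[x v] Vxv|[x v] [q _] [k _] /= [Bx /interior_subset]]; last exact.
  have [[/= A1 A2] [/= A1x A2v] A12] := open_nbhs_nbhs (conj oV Vxv).
  have [e/= e0 eA] : exists2 e : R, 0 < e & ball x e `<=` A1 by exact/nbhs_ballP.
  have [k kP] : exists k : nat, k.+1%:R^-1 < e / 2 :> R.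
    have e20 : 0 < e / 2 by rewrite divr_gt0.
    have [k _ kP] := near_infty_natSinv_lt (PosNum e20).
    by exists k; apply: kP => /=.
  have k0 : 0 < k.+1%:R^-1 :> R by rewrite invr_gt0.
  have /rat_in_itvoo[q] : x - k.+1%:R^-1 < x by rewrite ltrBlDr ltrDl.
  rewrite in_itv/= => /andP[q1 q2].
  exists q => //; exists k => //; split => /=.
    rewrite /B /ball /= ltr_distlC -ltrBlDr q1 andbT ltrBlDr.
    by rewrite (lt_trans q2)// ltrDl.
  apply: (filterS _ A2v) => w A2w y; rewrite /B /ball /= ltr_distlC => /andP[y1 y2].
  apply: (A12 (y, w)); split => //=; apply: eA.
  have aux (z a r y' : R) : 0 < r -> r < e / 2 -> z - r < a -> a < z ->
      a - r < y' -> y' < a + r -> z - e < y' < z + e.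
    by move=> *; apply/andP; split; lra.
  by rewrite /ball /= ltr_distlC; exact: (aux _ _ _ _ k0 kP q1 q2 y1 y2).
apply: (@bigcupT_measurable_rat _ (measurableTypeR R * borel R d)%type) => q.
apply: bigcupT_measurable => k.
apply: measurableX; first exact: measurable_realfun.measurable_ball.
by apply: open_measurable_borel; exact: open_interior.
Qed.

Local Open Scope ereal_scope.

Lemma ball0_bigcup d :
  [set: 'rV[R]_d] = \bigcup_k ball (0%R : 'rV[R]_d) k.+1%:R%R.
Proof.
apply/esym/seteqP; split => // v _; exists (Num.Def.archi_bound `|v|%R) => //.
rewrite -ball_normE /ball_ /= sub0r normrN.
by rewrite (lt_trans (archi_boundP _))// ltr_nat.
Qed.

Lemma cons_rV_ball0 d (e : R) :
  @cons_rV R d @^-1` ball (0%R : 'rV[R]_d.+1) e `<=`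
  ball (0%R : R) e `*` ball (0%R : 'rV[R]_d) e.
Proof.
move=> [x v] /= [e0 xv]; split => /=.
  have := xv 0%R 0%R; rewrite !mxE; case: splitP => k //= _.
  by rewrite !mxE !ord1 eqxx mulr1n.
have consE j : @fun_of_matrix R 1 (1 + d) (cons_rV (x, v)) 0%R (rshift 1 j) =
    fun_of_matrix (v : 'rV[R]_d) 0%R j by rewrite [LHS]row_mxEr.
split=> // i j; have := xv 0%R (rshift 1 j).
rewrite ord1 -consE; set z := cons_rV _ _ _; rewrite !mxE; exact.
Qed.

Let isM d (m : set (borel R d) -> \bar R) :=
  [/\ m set0 = 0, forall A, 0 <= m A, semi_sigma_additive m &
      forall k : nat, m (ball (0%R : 'rV[R]_d) k.+1%:R%R) < +oo].

Let isM_step d (m : {sigma_finite_measure set (borel R d) -> \bar R}) :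
  isM m ->
  isM (fun A => ((@lebesgue_measure R) \x m) (@cons_rV R d @^-1` A)).
Proof.
move=> [_ _ _ mfin]; split.
- by rewrite preimage_set0 measure0.
- by move=> A; exact: measure_ge0.
- move=> F mF tF mUF; rewrite preimage_bigcup.
  have mcons A : measurable A -> measurable (@cons_rV R d @^-1` A).
    by move=> mA; rewrite -[X in measurable X]setTI; exact: measurable_cons_rV.
  apply: measure_semi_sigma_additive.
  + by move=> n; exact: mcons.
  + apply/trivIsetP => /= i j _ _ ij; rewrite -preimage_setI.
    by move/trivIsetP : tF => /(_ _ _ _ _ ij) ->//; rewrite preimage_set0.
  + by rewrite -preimage_bigcup; exact: mcons.
- move=> k.
  have mb : measurable (ball (0%R : R) k.+1%:R%R : set (measurableTypeR R)).
    exact: measurable_realfun.measurable_ball.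
  have mb' : measurable (ball (0%R : 'rV[R]_d) k.+1%:R%R : set (borel R d)).
    by apply: open_measurable_borel; exact: ball_open.
  apply: (@le_lt_trans _ _ (((@lebesgue_measure R) \x m)
    (ball (0%R : R) k.+1%:R%R `*` ball (0%R : 'rV[R]_d) k.+1%:R%R))).
    apply: le_measure; rewrite ?inE; last exact: cons_rV_ball0.
    + rewrite -[X in measurable X]setTI; apply: measurable_cons_rV => //.
      by apply: open_measurable_borel; exact: ball_open.
    + exact: measurableX.
  rewrite product_measure1E//= lte_mul_pinfty//.
  by rewrite ge0_fin_numE// lebesgue_measure_ball// ltry.
Qed.

Lemma lebesgue_rV_spec d : isM (@lebesgue_rV R d).
Proof.
elim: d => [|d IH].
  pose m := @dirac _ (borel R 0) (0%R : 'rV[R]_0) R.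
  split.
  - exact: (measure0 m).
  - exact: (measure_ge0 m).
  - exact: (@measure_semi_sigma_additive _ _ _ m).
  - by move=> k; rewrite /= diracE ltry.
have [m0 m_ge0 m_sa m_fin] := IH.
have m_sf : sigma_finite setT (@lebesgue_rV R d).
  exists (fun k => ball (0%R : 'rV[R]_d) k.+1%:R%R); first exact: ball0_bigcup.
  move=> k; split => //; apply: open_measurable_borel; exact: ball_open.
pose M := isMeasure.Build _ _ _ (@lebesgue_rV R d) m0 m_ge0 m_sa.
pose mu0 : {measure set borel R d -> \bar R} := HB.pack (@lebesgue_rV R d) M.
pose SF := Measure_isSigmaFinite.Build _ _ _ mu0 m_sf.
pose mu : {sigma_finite_measure set borel R d -> \bar R} :=
  HB.pack (Measure.sort mu0) SF.
exact: (@isM_step d mu).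
Qed.

Section instances.
Variable d : nat.

Let leb0 : @lebesgue_rV R d set0 = 0.
Proof. by have [] := lebesgue_rV_spec d. Qed.

Let leb_ge0 A : 0 <= @lebesgue_rV R d A.
Proof. by have [] := lebesgue_rV_spec d. Qed.

Let leb_sigma_additive : semi_sigma_additive (@lebesgue_rV R d).
Proof. by have [] := lebesgue_rV_spec d. Qed.

HB.instance Definition _ := isMeasure.Build _ _ _ (@lebesgue_rV R d)
  leb0 leb_ge0 leb_sigma_additive.

Let leb_sigma_finite : sigma_finite setT (@lebesgue_rV R d).
Proof.
exists (fun k => ball (0%R : 'rV[R]_d) k.+1%:R%R); first exact: ball0_bigcup.
move=> k; split; last by have [] := lebesgue_rV_spec d.
by apply: open_measurable_borel; exact: ball_open.
Qed.

HB.instance Definition _ := Measure_isSigmaFinite.Build _ _ _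
  (@lebesgue_rV R d) leb_sigma_finite.
End instances.
End lebesgue_rV_is_measure.

Section euclidean.
Context {R : realType} {n : nat}.

Definition dot (x y : 'rV[R]_n) : R := (x *m y^T) 0 0.

Definition is_rotation (Q : 'M[R]_n) : Prop := Q *m Q^T = 1%:M /\ \det Q = 1.

Definition intv (k : 'rV[int]_n) : 'rV[R]_n := map_mx intr k.

End euclidean.

(** * Proper cones and lighthouse measures *)

Definition is_cone (R : realType) (n : nat) (C : set 'rV[R]_n) : Prop :=
  forall (x : 'rV[R]_n) (l : R), 0 < l -> (C x <-> C (l *: x)).

Record proper_cone (R : realType) (n : nat) (C : set 'rV[R]_n) : Prop := {
  proper_cone_cone : is_cone C ;
  proper_cone_closed : closed C ;
  proper_cone_convex : @convex_set R 'rV[R]_n C ;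
  proper_cone_interior : C^° !=set0 ;
  proper_cone_pointed : exists l : 'rV[R]_n,
    forall x, C x -> x != 0 -> 0 < dot l x
}.

Section lighthouse.
Context {R : realType} {n : nat}.
Implicit Types (mu : {measure set (borel R n) -> \bar R}) (C : set 'rV[R]_n).

(** On R^n, inner and outer regularity of a Borel measure follow from
    finiteness on compact sets. *)
Definition radon mu : Prop :=
  forall K : set 'rV[R]_n, compact K -> (mu K < +oo)%E.

Definition periodic mu : Prop :=
  forall (k : 'rV[int]_n) (A : set (borel R n)),
    measurable A -> mu [set x : 'rV[R]_n | A (x + intv k)] = mu A.

(** A fundamental domain of R^n / Z^n. *)
Definition unit_cell : set (borel R n) :=
  [set x : 'rV[R]_n | forall i, 0 <= x 0 i < 1].

Definition fourier_coef mu (k : 'rV[int]_n) : R[i] :=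
  Complex (\int[mu]_(x in unit_cell) cos (2 * pi * dot (intv k) x))
    (- \int[mu]_(x in unit_cell) sin (2 * pi * dot (intv k) x)).

Definition fourier_supp mu : set 'rV[int]_n :=
  [set k | fourier_coef mu k != 0].

Record lighthouse mu C : Prop := {
  lighthouse_radon : radon mu ;
  lighthouse_periodic : periodic mu ;
  lighthouse_cone : proper_cone C ;
  lighthouse_null_support : exists S : set 'rV[R]_n,
    [/\ closed S, lebesgue_rV (S : set (borel R n)) = 0%E & mu (~` S) = 0%E] ;
  lighthouse_spectrum : forall k, fourier_supp mu k ->
    C (- intv k) \/ C (intv k)
}.

End lighthouse.

(** * Submanifolds, volume and unit normals *)

Section submanifold.
Context {R : realType} {n : nat}.
Implicit Types (M : set 'rV[R]_n).

Definition C1holder (d c : nat) (eps : R) (U : set 'rV[R]_d)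
    (f : 'rV[R]_d -> 'rV[R]_c) : Prop :=
  (forall u, U u -> differentiable f u) /\
  exists K : R, forall u v, U u -> U v ->
    `|'J f u - 'J f v| <= K * `|u - v| `^ eps.

Definition graph_map (d c : nat) (E : (d + c)%N = n) (Q : 'M[R]_n)
    (f : 'rV[R]_d -> 'rV[R]_c) (u : 'rV[R]_d) : 'rV[R]_n :=
  castmx (erefl, E) (row_mx u (f u)) *m Q.

(** Inside the open set [W], [M] is the graph over [U] of [f], rotated by
    [Q]. *)
Definition graph_patch (eps : R) M (d c : nat) (E : (d + c)%N = n)
    (Q : 'M[R]_n) (U : set 'rV[R]_d) (f : 'rV[R]_d -> 'rV[R]_c)
    (W : set 'rV[R]_n) : Prop :=
  [/\ is_rotation Q, open U, C1holder eps U f, open W &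
      M `&` W = graph_map E Q f @` U].

(** The Hölder bound is uniform on each patch; since patches may be shrunk,
    this is the same as a local Hölder condition. *)
Definition C1holder_submanifold (d : nat) (eps : R) M : Prop :=
  forall x, M x -> exists (c : nat) (E : (d + c)%N = n) (Q : 'M[R]_n)
    (U : set 'rV[R]_d) (f : 'rV[R]_d -> 'rV[R]_c) (W : set 'rV[R]_n),
    W x /\ graph_patch eps M E Q U f W.

Definition gram_density (d : nat) (phi : 'rV[R]_d -> 'rV[R]_n)
    (u : 'rV[R]_d) : R :=
  Num.sqrt (\det ('J phi u *m ('J phi u)^T)).

(** The Riemannian volume of [M], as a Borel measure on R^n carried by [M]:
    in each patch it is given by the area formula. Patches cover [M], so this
    determines the measure uniquely. *)
Definition is_volume_measure (d : nat) (eps : R) M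
    (sigma : {measure set (borel R n) -> \bar R}) : Prop :=
  sigma (~` M) = 0%E /\
  forall (c : nat) (E : (d + c)%N = n) (Q : 'M[R]_n) (U : set 'rV[R]_d)
    (f : 'rV[R]_d -> 'rV[R]_c) (W : set 'rV[R]_n),
    graph_patch eps M E Q U f W ->
    forall A : set (borel R n), measurable A -> A `<=` W ->
      sigma A = (\int[@lebesgue_rV R d]_(u in U `&` graph_map E Q f @^-1` A)
                   (gram_density (graph_map E Q f) u)%:E)%E.

Definition tangent M (x v : 'rV[R]_n) : Prop :=
  exists gamma : R -> 'rV[R]_n,
    [/\ gamma 0 = x, \forall t \near (0 : R), M (gamma t) &
        is_derive (0 : R) (1 : R) gamma v].

(** For a hypersurface [M], an orientation is the same as the choice of such
    a field, up to values outside [M]. *)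
Definition unit_normal_field M (nu : 'rV[R]_n -> 'rV[R]_n) : Prop :=
  {within M, continuous nu} /\
  forall x, M x ->
    dot (nu x) (nu x) = 1 /\ (forall v, tangent M x v -> dot (nu x) v = 0).

End submanifold.

(* Main.v *)
Require Import Defs.
From mathcomp Require Import all_boot all_order all_algebra.
From mathcomp Require Import all_classical all_reals all_analysis.
From mathcomp Require Import measurable_realfun zify ring lra.
From mathcomp.real_closed Require Import complex.
Import Order.TTheory GRing.Theory Num.Theory.
Import numFieldNormedType.Exports.
Set Implicit Arguments.
Unset Strict Implicit.
Unset Printing Implicit Defensive.
Local Open Scope classical_set_scope.
Local Open Scope ring_scope.

(** A blow-up argument in which every Fourier integral is replaced by a finite
    sum. Let [xi] be normal to [M] at [x] and suppose that neither [xi] nor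
    [- xi] lies in [C]; a neighbourhood of [xi] then misses [C] and [- C]. Take
    an integer vector [k0] close to [p L xi] and let [K] be a power of the
    product Fejér kernel of degree [L] centred at [x]: for [p] large, every
    frequency of [cos (2 pi <k0, y - x>) K(y)] lies outside [C] and [- C], so
    this function has integral zero against [mu] over the unit cell. On the
    other hand [K] concentrates on the scale [1 / L] around [x], where [mu]
    sits on [M] and hence [<k0, y - x>] is almost [0] because [xi] is normal:
    this part of the integral is at least a constant times [L ^- d], while the
    decay of [K] makes the rest a small multiple of [L ^- d]. So every normal
    vector lies in [C] or in [- C]. As [C] is pointed, the normal space is at
    most a line, and it is not zero because [mu] has a null support. *)

(** * Fejér kernel *)

(** Two scales compete. The kernel has bandwidth of order [(d + 1) n L], so for its frequencies to
    stay inside the angular gap around [xi], [k0] must have length of order [p L], with [p] fixed by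
    the gap. On the central ball of radius [R0 / L] such a phase could reach order [p R0], which is
    not small; it is small on [M] only because there [<xi, y - x>] is at most [eta |y - x|], with
    [eta] as small as desired close to [x]. The constants are therefore fixed in the order [p],
    [R0], [eta], [L], and no choice depends on a later one. The kernel is nonnegative, so off the
    central ball the integrand is at least minus the kernel, whatever the cosine does there. The
    mass of a ball of radius [t] must be comparable to [t ^+ d] from both sides: the lower bound
    feeds the peak, the upper bound controls the dyadic shells. For the orientation, [C] and [- C]
    meet only in [0], so a normal line contains exactly one unit vector of [C]. It is the one on
    which the linear form positive on [C] is positive, and this sign cannot jump; the choice is thus
    continuous. *)

Section trigonometry.
Context {R : realType}.
Implicit Types (t x : R) (L : nat).

Lemma norm_sin_le x : `|sin x| <= `|x|.
Proof.
wlog x0 : x / 0 <= x.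
  move=> h; have [/h //|/ltW xneg] := leP 0 x.
  by rewrite -(normrN (sin x)) -sinN -(normrN x); apply: h; rewrite oppr_ge0.
have [c _ ] : exists2 c, c \in `[0, x]%R & sin x - sin 0 = cos c * (x - 0).
  by apply: MVT_segment => //; apply: continuous_subspaceT => ?; exact: continuous_sin.
rewrite sin0 !subr0 => ->; rewrite normrM ler_piMl// ; exact: cos_max.
Qed.

Lemma cos_ge_half x : `|x| <= 1 -> 1 / 2 <= cos x.
Proof.
move=> x1.
have -> : x = (x / 2) *+ 2 by rewrite mulr2n; lra.
rewrite cos_mulr2n cos2sin2.
have : sin (x / 2) ^+ 2 <= (x / 2) ^+ 2.
  by rewrite -[leLHS]real_normK ?num_real// -[leRHS]real_normK ?num_real// lerXn2r ?nnegrE ?norm_sin_le.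
have : x ^+ 2 <= 1 by rewrite -[leLHS]real_normK ?num_real// expr_le1.
rewrite exprMn exprVn (_ : 2 ^+ 2 = 4 :> R) ?(mulr2n (1 - _)); last by ring.
move: (x ^+ 2) (sin _ ^+ 2) => a b; lra.
Qed.

(** A weak Jordan inequality without concavity: on [[0, 1]] the mean value theorem with
    [cos >= 1 / 2] gives [x / 2]; beyond [1] the sine increases from at least [1 / 2], while
    [x / 4 < 1 / 2] because [pi / 2 < 2]. *)
Lemma sin_ge_quarter x : 0 <= x <= pi / 2 -> x / 4 <= sin x.
Proof.
have small (y : R) : 0 <= y <= 1 -> y / 2 <= sin y.
  move=> /andP[y0 y1].
  have [c cy] : exists2 c, c \in `[0, y]%R & sin y - sin 0 = cos c * (y - 0).
    by apply: MVT_segment => //; apply: continuous_subspaceT => ?; exact: continuous_sin.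
  rewrite sin0 !subr0 => ->; rewrite mulrC ler_wpM2r//.
  have := @cos_ge_half c; move: cy; rewrite in_itv/= => /andP[c0 cy] h.
  by have := h _; rewrite ger0_norm// (le_trans cy)// => /(_ isT); lra.
move=> /andP[x0 xpi]; have [x1|/ltW x1] := leP x 1.
  by apply: le_trans (small _ _); rewrite ?x0//; lra.
have pi2 := @pihalf_lt2 R; have pi1 := @pihalf_ge1 R.
have : sin 1 <= sin x.
  by rewrite leNgt ltr_sin ?in_itv /= -?leNgt//; apply/andP; split; lra.
have := small 1; rewrite ler01 lexx => /(_ isT); lra.
Qed.

Lemma cosD_int x (z : int) : cos (x + 2 * pi * z%:~R) = cos x.
Proof.
have nat_case (y : R) (k : nat) : cos (y + 2 * pi * k%:R) = cos y.
  rewrite (_ : 2 * pi * k%:R = pi *+ 2 *+ k); last first.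
    by rewrite -[RHS]mulr_natr mulr2n; ring.
  exact: (periodicn (@cosD2pi R)).
case: z => k; first exact: nat_case.
by rewrite NegzE mulrNz mulrN -[in RHS](subrK (2 * pi * k.+1%:R) x) nat_case.
Qed.

(** The Fejér kernel divided by [L], so that its peak value is [1]. The double sum displays the
    frequencies [a - b]; the sum of two squares in [fejerE] displays the sign. *)
Definition fejer L t : R :=
  (\sum_(a < L) \sum_(b < L) cos (2 * pi * ((a%:Z - b%:Z)%:~R * t))) / L%:R ^+ 2.

Lemma fejerE L t : fejer L t =
  ((\sum_(a < L) cos (2 * pi * (a%:R * t))) ^+ 2 +
   (\sum_(a < L) sin (2 * pi * (a%:R * t))) ^+ 2) / L%:R ^+ 2.
Proof.
congr (_ / _); rewrite !expr2 !big_distrlr -big_split; apply: eq_bigr => a _ /=.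
rewrite -big_split; apply: eq_bigr => b _ /=; rewrite -cosB -mulrBr -mulrBl.
by rewrite intrB.
Qed.

Lemma fejer_ge0 L t : 0 <= fejer L t.
Proof. by rewrite fejerE divr_ge0 ?addr_ge0 ?sqr_ge0. Qed.

Lemma fejer_le1 L t : fejer L t <= 1.
Proof.
case: L => [|L]; first by rewrite /fejer big_ord0 mul0r ler01.
rewrite /fejer ler_pdivrMr ?exprn_gt0 ?ltr0n// mul1r expr2.
apply: (@le_trans _ _ (\sum_(a < L.+1) \sum_(b < L.+1) 1)).
  by apply: ler_sum => a _; apply: ler_sum => b _; exact: cos_le1.
by rewrite !sumr_const !card_ord -mulrnA -natrM.
Qed.

Lemma fejerD_int L t (z : int) : fejer L (t + z%:~R) = fejer L t.
Proof.
congr (_ / _); apply: eq_bigr => a _; apply: eq_bigr => b _.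
rewrite -[RHS](cosD_int _ ((a%:Z - b%:Z) * z)) intrM.
by congr cos; ring.
Qed.

(** Since [|a - b| <= L] and [pi < 4], the factor [8] keeps every phase in [[-1, 1]], where the
    cosine is at least [1 / 2]: the bound holds term by term. *)
Lemma fejer_ge_half L t : (0 < L)%N -> `|t| * (8 * L%:R) <= 1 -> 1 / 2 <= fejer L t.
Proof.
move=> L0 tL; rewrite /fejer ler_pdivlMr ?exprn_gt0 ?ltr0n//.
apply: (@le_trans _ _ (\sum_(a < L) \sum_(b < L) (1 / 2))).
  by rewrite !sumr_const !card_ord -mulrnA -[leRHS]mulr_natr natrM expr2.
apply: ler_sum => a _; apply: ler_sum => b _; apply: cos_ge_half.
have abL : `|(a%:Z - b%:Z)%:~R| <= L%:R :> R.
  rewrite intrB ler_norml; have := ltn_ord a; have := ltn_ord b.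
  rewrite -!(ltr_nat R) -!pmulrn => bL aL.
  have a0 : 0 <= (a : nat)%:R :> R by []; have b0 : 0 <= (b : nat)%:R :> R by [].
  by apply/andP; split; lra.
have pi4 := @pihalf_lt2 R; have pi0 := @pi_gt0 R.
rewrite !normrM (ger0_norm (ltW pi0)) (ger0_norm (ler0n _ 2)).
apply: (@le_trans _ _ (2 * 4 * (L%:R * `|t|))); last by lra.
by apply: ler_pM => //; [lra|lra|exact: ler_wpM2r].
Qed.

(** With [h = pi t], each term [2 sin h cos (2 a h)] equals [sin ((2 a + 1) h) - sin ((2 a - 1) h)],
    so the sum telescopes and is bounded independently of [L]. *)
Lemma sin_mul_sum_cos L t :
  2 * sin (pi * t) * (\sum_(a < L) cos (2 * pi * (a%:R * t))) =
  sin ((2 * L%:R - 1) * (pi * t)) + sin (pi * t).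
Proof.
elim: L => [|L IH].
  by rewrite big_ord0 mulr0 mulr0 sub0r mulN1r sinN addNr.
rewrite big_ord_recr mulrDr IH /=.
have -> : (2 * L.+1%:R - 1) * (pi * t) = 2 * pi * (L%:R * t) + pi * t.
  by rewrite -natr1; ring.
have -> : (2 * L%:R - 1) * (pi * t) = 2 * pi * (L%:R * t) - pi * t by ring.
rewrite sinB sinD; ring.
Qed.

Lemma sin_mul_sum_sin L t :
  2 * sin (pi * t) * (\sum_(a < L) sin (2 * pi * (a%:R * t))) =
  cos (pi * t) - cos ((2 * L%:R - 1) * (pi * t)).
Proof.
elim: L => [|L IH].
  by rewrite big_ord0 mulr0 mulr0 sub0r mulN1r cosN subrr.
rewrite big_ord_recr mulrDr IH /=.
have -> : (2 * L.+1%:R - 1) * (pi * t) = 2 * pi * (L%:R * t) + pi * t.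
  by rewrite -natr1; ring.
have -> : (2 * L%:R - 1) * (pi * t) = 2 * pi * (L%:R * t) - pi * t by ring.
rewrite cosB cosD; ring.
Qed.

(** By telescoping, [sin (pi t) ^+ 2] times each of the two squared sums is at most [1], and
    [sin (pi t) ^+ 2 >= t ^+ 2 / 4]; hence [8 = 2 * 4]. *)
Lemma fejer_le L t : t != 0 -> `|t| <= 1 / 2 ->
  fejer L t <= 8 / (L%:R * `|t|) ^+ 2.
Proof.
move=> t0 t2.
case: L => [|L]; first by rewrite /fejer big_ord0 !mul0r expr0n/= invr0 mulr0.
have pi2 := @pi_ge2 R.
have sin_lb : (t / 2) ^+ 2 <= sin (pi * t) ^+ 2.
  rewrite -[leRHS]real_normK ?num_real// -[leLHS]real_normK ?num_real//.
  rewrite lerXn2r ?nnegrE//.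
  wlog tpos : t t0 t2 / 0 <= t.
    move=> h; have [/h->//|/ltW tneg] := leP 0 t.
    rewrite -(normrN (t / 2)) -(normrN (sin _)) -sinN -mulNr -mulrN.
    by apply: h; rewrite ?oppr_eq0 ?normrN// oppr_ge0.
  rewrite (ger0_norm tpos) in t2.
  rewrite (ger0_norm (divr_ge0 tpos _))//; apply: le_trans (ler_norm _).
  apply: le_trans (sin_ge_quarter _).
    by rewrite ler_pdivlMr//; nra.
  by apply/andP; split; [rewrite mulr_ge0//; lra|nra].
have sC : (2 * sin (pi * t) * (\sum_(a < L.+1) cos (2 * pi * (a%:R * t)))) ^+ 2 <= 4.
  rewrite sin_mul_sum_cos -real_normK ?num_real//.
  rewrite (_ : 4 = 2 ^+ 2); last by ring.
  rewrite lerXn2r ?nnegrE//; apply: (le_trans (ler_normD _ _)).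
  have := sin_max ((2 * L.+1%:R - 1) * (pi * t)); have := sin_max (pi * t); lra.
have sS : (2 * sin (pi * t) * (\sum_(a < L.+1) sin (2 * pi * (a%:R * t)))) ^+ 2 <= 4.
  rewrite sin_mul_sum_sin -real_normK ?num_real//.
  rewrite (_ : 4 = 2 ^+ 2); last by ring.
  rewrite lerXn2r ?nnegrE//; apply: (le_trans (ler_normB _ _)).
  have := cos_max ((2 * L.+1%:R - 1) * (pi * t)); have := cos_max (pi * t); lra.
have Lp : 0 < L.+1%:R ^+ 2 :> R by rewrite exprn_gt0.
have tp : 0 < t ^+ 2 by rewrite lt_def sqrf_eq0 t0 sqr_ge0.
rewrite fejerE exprMn real_normK ?num_real// ler_pdivrMr//.
rewrite [leRHS](_ : _ = 8 / t ^+ 2); last by field; rewrite t0/= (_ : 1 = 1%:R)// -natrD pnatr_eq0.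
rewrite ler_pdivlMr//.
move: sC sS sin_lb; rewrite !exprMn.
have -> : 2 ^+ 2 = 4 :> R by ring.
have -> : 2^-1 ^+ 2 = 4^-1 :> R by rewrite exprVn; congr (_^-1); ring.
have := sqr_ge0 (\sum_(a < L.+1) cos (2 * pi * (a%:R * t))).
have := sqr_ge0 (\sum_(a < L.+1) sin (2 * pi * (a%:R * t))).
move: (sin _ ^+ 2) (_ ^+ 2) (_ ^+ 2) (t ^+ 2) tp => s2 S2 C2 t2' tp S0 C0 sC sS sl.
have : t2' / 4 * C2 <= s2 * C2 by exact: ler_wpM2r.
have : t2' / 4 * S2 <= s2 * S2 by exact: ler_wpM2r.
lra.
Qed.
End trigonometry.

(** * Band-limited functions on the torus *)

Section matrix_norm.
Context {R : realType} {m n : nat}.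
Implicit Types A : 'M[R]_(m, n).

Lemma norm_coord_le A i j : `|A i j| <= `|A|.
Proof.
rewrite [`|A|]mx_normrE.
exact: (le_trans _ (le_bigmax _ _ (i, j))).
Qed.

Lemma mx_norm_le A (e : R) : 0 <= e -> (forall i j, `|A i j| <= e) -> `|A| <= e.
Proof.
by move=> e0 Ae; rewrite [`|A|]mx_normrE; apply/bigmax_leP; split => // -[].
Qed.

End matrix_norm.

Lemma mulmx_norm_le {R : realType} (m n p : nat) (A : 'M[R]_(m, n))
  (B : 'M[R]_(n, p)) : `|A *m B| <= n%:R * `|A| * `|B|.
Proof.
apply: mx_norm_le; first by rewrite !mulr_ge0.
move=> i j; rewrite mxE; apply: le_trans (ler_norm_sum _ _ _) _.
apply: (@le_trans _ _ (\sum_(k < n) `|A| * `|B|)).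
  by apply: ler_sum => k _; rewrite normrM ler_pM ?norm_coord_le.
by rewrite sumr_const card_ord -[leLHS]mulr_natl mulrA.
Qed.

Lemma lipschitz_continuous {R : realType} {V W : normedModType R} (K : R)
  (f : V -> W) : (forall x y, `|f x - f y| <= K * `|x - y|) -> continuous f.
Proof.
move=> fK x; apply/cvgrPdist_lt => e e0; near=> y.
apply: le_lt_trans (fK _ _) _.
apply: (@le_lt_trans _ _ ((`|K| + 1) * `|x - y|)).
  by rewrite ler_wpM2r// (le_trans (ler_norm K))// lerDl.
rewrite mulrC -ltr_pdivlMr ?ltr_wpDl//; near: y.
apply/nbhs_ballP; exists (e / (`|K| + 1)) => /= [|z]; last by rewrite -ball_normE.
by rewrite divr_gt0// ltr_wpDl.
Unshelve. all: by end_near. Qed.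

Section continuous_fun.
Context {R : realType} {T : topologicalType}.
Implicit Types f g : T -> R.

Lemma continuousDf f g : continuous f -> continuous g ->
  continuous (fun y => f y + g y).
Proof. by move=> cf cg y; exact: cvgD (cf y) (cg y). Qed.

Lemma continuousMf f g : continuous f -> continuous g ->
  continuous (fun y => f y * g y).
Proof. by move=> cf cg y; exact: cvgM (cf y) (cg y). Qed.
End continuous_fun.

Section dot_theory.
Context {R : realType} {n : nat}.
Implicit Types x y : 'rV[R]_n.

Lemma dotE x y : dot x y = \sum_j x 0 j * y 0 j.
Proof. by rewrite /dot mxE; apply: eq_bigr => j _; rewrite mxE. Qed.

Lemma dotC x y : dot x y = dot y x.
Proof. by rewrite !dotE; apply: eq_bigr => j _; rewrite mulrC. Qed.

Lemma dotDl x y z : dot (x + y) z = dot x z + dot y z.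
Proof. by rewrite /dot mulmxDl mxE. Qed.

Lemma dotZl a x y : dot (a *: x) y = a * dot x y.
Proof. by rewrite /dot -scalemxAl mxE. Qed.

Lemma dotNl x y : dot (- x) y = - dot x y.
Proof. by rewrite /dot mulNmx mxE. Qed.

Lemma dotDr x y z : dot x (y + z) = dot x y + dot x z.
Proof. by rewrite dotC dotDl !(dotC x). Qed.

Lemma dotZr a x y : dot x (a *: y) = a * dot x y.
Proof. by rewrite dotC dotZl dotC. Qed.

Lemma dotNr x y : dot x (- y) = - dot x y.
Proof. by rewrite dotC dotNl dotC. Qed.

Lemma dotBr x y z : dot x (y - z) = dot x y - dot x z.
Proof. by rewrite dotDr dotNr. Qed.

Lemma dot_norm_le x y : `|dot x y| <= n%:R * `|x| * `|y|.
Proof.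
apply: le_trans (norm_coord_le (x *m y^T) 0 0) _.
apply: le_trans (mulmx_norm_le _ _) _; rewrite ler_wpM2l ?mulr_ge0//.
by apply: mx_norm_le => // i j; rewrite mxE norm_coord_le.
Qed.

Lemma dot_ge0 x : 0 <= dot x x.
Proof. by rewrite dotE sumr_ge0// => j _; rewrite -expr2 sqr_ge0. Qed.

Lemma dot_eq0 x : (dot x x == 0) = (x == 0).
Proof.
apply/eqP/eqP => [|->]; last by rewrite /dot mul0mx mxE.
rewrite dotE => /eqP; rewrite psumr_eq0; last first.
  by move=> j _; rewrite -expr2 sqr_ge0.
move=> /allP x0; apply/rowP => j; rewrite mxE; apply/eqP.
by have := x0 j (mem_index_enum _); rewrite -expr2 sqrf_eq0.
Qed.

Lemma dot_gt0 x : (0 < dot x x) = (x != 0).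
Proof. by rewrite lt_def dot_ge0 andbT dot_eq0. Qed.

Lemma dot_continuous x : continuous (dot x).
Proof.
apply: (@lipschitz_continuous _ _ _ (n%:R * `|x|)) => y z.
by rewrite -dotBr dot_norm_le.
Qed.

Lemma dot_intv (k v : 'rV[int]_n) :
  dot (intv k : 'rV[R]_n) (intv v) = (\sum_j k 0 j * v 0 j)%:~R.
Proof.
by rewrite dotE raddf_sum; apply: eq_bigr => j _; rewrite !mxE -intrM.
Qed.

End dot_theory.

Section unit_cell.
Context {R : realType} {n : nat} (mu : {measure set (borel R n) -> \bar R}).
Hypothesis mu_radon : radon mu.
Implicit Types (f g : 'rV[R]_n -> R).

Lemma continuous_measurable_rV g : continuous g ->
  measurable_fun [set: borel R n] (g : borel R n -> R).
Proof.
move=> cg; apply: (measurability _ (RGenOpens.measurableE R)).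
move=> _ [_ [a [b ->] <-]]; rewrite setTI; apply: open_measurable_borel.
by apply: open_comp => [x _|]; [exact: cg|exact: interval_open].
Qed.

Lemma measurable_unit_cell : measurable (@unit_cell R n).
Proof.
rewrite (_ : unit_cell = \bigcap_(i in [set: 'I_n])
    ((fun x : 'rV[R]_n => x 0 i) @^-1` `[0, 1[%classic)); last first.
  by apply/seteqP; split => x /= h i; have := h i; rewrite /= in_itv/=; auto.
apply: fin_bigcap_measurable => [|i _]; first exact: finite_finset.
rewrite -[X in measurable X]setTI.
by apply: continuous_measurable_rV => //; exact: coord_continuous.
Qed.

Let cube : set 'rV[R]_n := [set x | forall i, x 0 i \in `[0, 1]].

Let cube_compact : compact cube.
Proof.
have := @rV_compact R n (fun=> `[0, 1]%classic) (fun=> @segment_compact R 0 1).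
exact.
Qed.

Let cell_cube : unit_cell `<=` cube.
Proof. by move=> x xc i; rewrite in_itv/=; have /andP[-> /ltW] := xc i. Qed.

Lemma unit_cell_fin : (mu (@unit_cell R n) < +oo)%E.
Proof.
apply: le_lt_trans (mu_radon cube_compact).
apply: le_measure; rewrite ?inE//; first exact: measurable_unit_cell.
rewrite -[X in measurable X]setCK; apply: measurableC.
apply: open_measurable_borel; apply: closed_openC.
by apply: compact_closed => //; exact: norm_hausdorff.
Qed.

Lemma cell_integrable g : continuous g ->
  mu.-integrable unit_cell (EFin \o (g : borel R n -> R)).
Proof.
move=> cg; apply: measurable_bounded_integrable.
- exact: measurable_unit_cell.
- exact: unit_cell_fin.
- by apply: measurable_funTS; exact: continuous_measurable_rV.
- have : compact (g @` cube).
    apply: continuous_compact => //; exact: continuous_subspaceT.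
  move=> /compact_bounded [M [Mr MP]]; exists M; split => // y My x xc.
  by apply: (MP _ My); exists x => //; exact: cell_cube.
Qed.

(* [g] multiplies like a trigonometric polynomial all of whose frequencies lie
   in the cube [[- r, r]^n]. *)
Definition band_limited (r : nat) g := continuous g /\
  forall (k0 : 'rV[int]_n) (phi : R),
    (forall k : 'rV[int]_n, (forall j, `|k 0 j - k0 0 j| <= r%:Z) ->
      fourier_coef mu k = 0) ->
    \int[mu]_(y in unit_cell) (cos (2 * pi * dot (intv k0) y + phi) * g y) = 0.

Lemma cos_mode_continuous (k : 'rV[int]_n) (phi : R) :
  continuous (fun y : 'rV[R]_n => cos (2 * pi * dot (intv k) y + phi)).
Proof.
have ca : continuous (fun y : 'rV[R]_n => 2 * pi * dot (intv k) y + phi).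
  apply: continuousDf; last exact: cst_continuous.
  by apply: continuousMf; [exact: cst_continuous|exact: dot_continuous].
by move=> y; apply: continuous_comp; [exact: ca|exact: continuous_cos].
Qed.

Lemma sin_mode_continuous (k : 'rV[int]_n) (phi : R) :
  continuous (fun y : 'rV[R]_n => sin (2 * pi * dot (intv k) y + phi)).
Proof.
have ca : continuous (fun y : 'rV[R]_n => 2 * pi * dot (intv k) y + phi).
  apply: continuousDf; last exact: cst_continuous.
  by apply: continuousMf; [exact: cst_continuous|exact: dot_continuous].
by move=> y; apply: continuous_comp; [exact: ca|exact: continuous_sin].
Qed.

(** Expanding [cos (_ + phi)] leaves the real and imaginary parts of one Fourier coefficient. The
    free phase [phi] is what lets the later products absorb the centre of the kernel. *)
Lemma band_limited1 : band_limited 0 (cst 1).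
Proof.
split=> [|k0 phi k0P]; first exact: cst_continuous.
have /eqP : fourier_coef mu k0 = 0 by apply: k0P => j; rewrite subrr normr0.
rewrite eq_complex/= oppr_eq0 => /andP[/eqP c0 /eqP s0].
have cc := @cos_mode_continuous k0 0; have sc := @sin_mode_continuous k0 0.
have Zc (a : R) (h : 'rV[R]_n -> R) : continuous h ->
    mu.-integrable unit_cell (EFin \o ((fun y => a * h y) : borel R n -> R)).
  move=> ch; apply: cell_integrable; apply: continuousMf => //.
  exact: cst_continuous.
transitivity (\int[mu]_(y in unit_cell)
   (cos phi * cos (2 * pi * dot (intv k0) y + 0)
   + - sin phi * sin (2 * pi * dot (intv k0) y + 0))).
  by apply: eq_Rintegral => y _; rewrite mulr1 cosD addr0; ring.
have mc := measurable_unit_cell.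
rewrite RintegralD//; [|exact: Zc|exact: Zc].
rewrite !RintegralZl//; [|exact: cell_integrable|exact: cell_integrable].
under eq_Rintegral do rewrite addr0.
under [X in _ + _ * X]eq_Rintegral do rewrite addr0.
by rewrite c0 s0 !mulr0 addr0.
Qed.

Lemma band_limitedZ r a g : band_limited r g -> band_limited r (fun y => a * g y).
Proof.
move=> [cg gP]; split => [|k0 phi /gP-/(_ phi) g0].
  by apply: continuousMf => //; exact: cst_continuous.
transitivity (\int[mu]_(y in unit_cell)
    (a * (cos (2 * pi * dot (intv k0) y + phi) * g y))).
  by apply: eq_Rintegral => y _; ring.
rewrite RintegralZl ?g0 ?mulr0//; first exact: measurable_unit_cell.
by apply: cell_integrable; apply: continuousMf => //; exact: cos_mode_continuous.
Qed.

Lemma band_limitedD r f g : band_limited r f -> band_limited r g ->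
  band_limited r (fun y => f y + g y).
Proof.
move=> [cf fP] [cg gP]; split => [|k0 phi H]; first exact: continuousDf.
under eq_Rintegral do rewrite mulrDr.
rewrite RintegralD ?fP ?gP ?addr0//; first exact: measurable_unit_cell.
- by apply: cell_integrable; apply: continuousMf => //; exact: cos_mode_continuous.
- by apply: cell_integrable; apply: continuousMf => //; exact: cos_mode_continuous.
Qed.

Lemma band_limited_sum r (I : Type) (s : seq I) (f : I -> 'rV[R]_n -> R) :
  (forall i, band_limited r (f i)) -> band_limited r (fun y => \sum_(i <- s) f i y).
Proof.
move=> fP; elim: s => [|i s IH].
  under eq_fun do rewrite big_nil; split; first exact: cst_continuous.
  move=> k0 phi _; rewrite /Rintegral.
  by under eq_integral do rewrite mulr0; rewrite integral0.
by under eq_fun do rewrite big_cons; exact: band_limitedD.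
Qed.

(** Product-to-sum: the factor moves the frequency [k0] to [k0 + a e_j] and [k0 - a e_j] and changes
    the phase by a constant. A cube of radius [r] around either new centre lies in the cube of
    radius [r + s] around [k0]. *)
Lemma band_limited_cos r (s : nat) (j : 'I_n) (a : int) (t : R) g : `|a| <= s%:Z ->
  band_limited r g ->
  band_limited (r + s) (fun y => g y * cos (2 * pi * (a%:~R * (y 0 j - t)))).
Proof.
move=> a_s [cg gP]; split => [|k0 phi H].
  apply: continuousMf => // y.
  apply: (@continuous_comp _ _ _ (fun y : 'rV[R]_n => 2 * pi * (a%:~R * (y 0 j - t))) cos); last exact: continuous_cos.
  move: y; apply: continuousMf; first exact: cst_continuous.
  apply: continuousMf; first exact: cst_continuous.
  apply: continuousDf; [exact: coord_continuous|exact: cst_continuous].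
pose e : 'rV[int]_n := delta_mx 0 j.
have dote y : dot (intv e) y = y 0 j.
  rewrite dotE (bigD1 j)//= big1 => [|i ij]; rewrite !mxE.
    by rewrite !eqxx mul1r addr0.
  by rewrite (negbTE ij) andbF mul0r.
have intvD (k l : 'rV[int]_n) : intv (k + l) = intv k + intv l :> 'rV[R]_n.
  by apply/rowP => i; rewrite !mxE intrD.
have intvZ (b : int) : intv (b *: e) = b%:~R *: intv e :> 'rV[R]_n.
  by apply/rowP => i; rewrite !mxE intrM.
have H' (b : int) : `|b| = `|a| -> forall phi',
    \int[mu]_(y in unit_cell) (cos (2 * pi * dot (intv (k0 + b *: e)) y + phi') * g y) = 0.
  move=> ba phi'; apply: gP => k kP; apply: H => i.
  rewrite (_ : k 0 i - k0 0 i = (k 0 i - (k0 + b *: e) 0 i) + b * e 0 i).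
    apply: (le_trans (ler_normD _ _)); rewrite PoszD lerD//.
    apply: le_trans a_s; rewrite normrM ba ler_piMr//.
    by rewrite !mxE eqxx/=; case: eqP.
  by rewrite !mxE; ring.
have ci (b : int) phi' : mu.-integrable unit_cell
    (EFin \o ((fun y => cos (2 * pi * dot (intv (k0 + b *: e)) y + phi') * g y) : borel R n -> R)).
  by apply: cell_integrable; apply: continuousMf => //; exact: cos_mode_continuous.
pose p1 := phi - 2 * pi * (a%:~R * t); pose p2 := phi + 2 * pi * (a%:~R * t).
transitivity (\int[mu]_(y in unit_cell)
  (2^-1 * (cos (2 * pi * dot (intv (k0 + a *: e)) y + p1) * g y +
           cos (2 * pi * dot (intv (k0 + (- a) *: e)) y + p2) * g y))).
  apply: eq_Rintegral => y _; rewrite !intvD !intvZ !dotDl !dotZl dote.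
  set u := 2 * pi * dot (intv k0) y + phi; set v := 2 * pi * (a%:~R * (y 0 j - t)).
  rewrite (_ : 2 * pi * (_ + a%:~R * _) + p1 = u + v); last by rewrite /u /v /p1; ring.
  rewrite (_ : 2 * pi * (_ + (- a)%:~R * _) + p2 = u - v); last first.
    by rewrite mulrNz /u /v /p2; ring.
  by clearbody u v; rewrite cosB cosD; field.
rewrite RintegralZl; [|exact: measurable_unit_cell|]; last first.
  by apply: cell_integrable; apply: continuousDf; apply: continuousMf => //;
    exact: cos_mode_continuous.
rewrite RintegralD; [|exact: measurable_unit_cell|exact: ci|exact: ci].
by rewrite !H' ?normrN// addr0 mulr0.
Qed.

Lemma band_limited_fejer r L (j : 'I_n) (t : R) g : band_limited r g ->
  band_limited (r + L) (fun y => g y * fejer L (y 0 j - t)).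
Proof.
move=> gP; rewrite (_ : (fun y => _) = fun y => (L%:R ^+ 2)^-1 *
    (\sum_(a < L) \sum_(b < L)
     g y * cos (2 * pi * ((a%:Z - b%:Z)%:~R * (y 0 j - t))))); last first.
  apply/funext => y; rewrite /fejer.
  under [in RHS]eq_bigr do rewrite -mulr_sumr.
  by rewrite -mulr_sumr; ring.
apply: band_limitedZ; apply: band_limited_sum => a; apply: band_limited_sum => b.
apply: band_limited_cos => //.
have := ltn_ord a; have := ltn_ord b; lia.
Qed.

Lemma band_limited_prod_fejer r L (x : 'rV[R]_n) (s : seq 'I_n) g :
  band_limited r g ->
  band_limited (r + size s * L) (fun y => g y * \prod_(j <- s) fejer L (y 0 j - x 0 j)).
Proof.
elim: s r g => [|j s IH] r g gP.
  by under eq_fun do rewrite big_nil mulr1; rewrite mul0n addn0.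
under eq_fun do rewrite big_cons mulrA.
by rewrite /= mulSn addnA; apply: IH; exact: band_limited_fejer.
Qed.

(** All factors lie in [[0, 1]], so one coordinate far from [x] modulo [1] already makes the product
    small; the power [m] sets the rate of decay. *)
Definition torus_kernel (m L : nat) (x y : 'rV[R]_n) : R :=
  (\prod_j fejer L (y 0 j - x 0 j)) ^+ m.

(** Every factor is charged to the radius of the whole cube although it involves a single
    coordinate. The resulting factor [n] is harmless: [p] absorbs it in [spectrum_vanish]. *)
Lemma band_limited_kernel m L x : band_limited (m * (n * L)) (torus_kernel m L x).
Proof.
elim: m => [|m IH].
  rewrite mul0n /torus_kernel.
  by under eq_fun do rewrite expr0; exact: band_limited1.
rewrite /torus_kernel mulSn addnC; under eq_fun do rewrite exprSr.
have := @band_limited_prod_fejer _ L x (index_enum 'I_n) _ IH.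
have -> : size (index_enum 'I_n) = n by rewrite [index_enum _]unlock -enumT size_enum_ord.
exact.
Qed.

End unit_cell.

(** * Folding a periodic measure *)

Section borel.
Context {R : realType}.

Lemma measurable_continuous_preimage m n (h : 'rV[R]_m -> 'rV[R]_n)
    (A : set (borel R n)) :
  continuous h -> measurable A -> measurable (h @^-1` A : set (borel R m)).
Proof.
move=> ch mA; have mh : measurable_fun [set: borel R m] (h : borel R m -> borel R n).
  apply: (@measurability _ _ (borel R m) (borel R n) setT h (@open 'rV[R]_n)) => //.
  move=> _ [U oU <-]; rewrite setTI; apply: open_measurable_borel.
  by apply: open_comp => // z _; exact: ch.
by rewrite -[X in measurable X]setTI; exact: mh.
Qed.

Lemma rV_ballP n (x y : 'rV[R]_n) (t : R) : 0 < t ->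
  ball x t y <-> forall j, `|x 0 j - y 0 j| < t.
Proof.
move=> t0; split=> [[_ xy] j|xy]; first exact: xy.
by split => // i j; rewrite ord1; exact: xy.
Qed.

End borel.

Lemma norm_sub_round {R : realType} (t : R) :
  `|t + (- Num.floor (t + 1 / 2))%:~R| <= 1 / 2.
Proof.
have f1 := floor_le (t + 1 / 2); have f2 := lt_succ_floor (t + 1 / 2).
by rewrite intrN ler_norml; rewrite intrD in f2; apply/andP; split; lra.
Qed.

Section periodic_measure.
Context {R : realType} {n : nat} (mu : {measure set (borel R n) -> \bar R}).
Hypothesis mu_periodic : Defs.periodic mu.
Implicit Types (E : set (borel R n)) (x y : 'rV[R]_n) (v w : 'rV[int]_n).

(** The full preimage in R^n of the image of [E] in the torus; its trace on [unit_cell] represents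
    that image. *)
Definition translates E : set (borel R n) :=
  [set y : 'rV[R]_n | exists v : 'rV[int]_n, E (y + intv v)].

Lemma intvN v : intv (- v) = - intv v :> 'rV[R]_n.
Proof. by apply/rowP => j; rewrite !mxE intrN. Qed.

Lemma intvD v w : intv (v + w) = intv v + intv w :> 'rV[R]_n.
Proof. by apply/rowP => j; rewrite !mxE intrD. Qed.

Lemma unit_cell_translate x : exists v, unit_cell (x - intv v).
Proof.
exists (\row_j Num.floor (x 0 j)) => j; rewrite !mxE.
by rewrite subr_ge0 ltrBlDl floor_le andTb -[X in _ + X]/(1%:~R) -intrD lt_succ_floor.
Qed.

Lemma unit_cell_translate_inj x v w :
  unit_cell (x - intv v) -> unit_cell (x - intv w) -> v = w.
Proof.
move=> vx wx; apply/rowP => j; have := vx j; have := wx j; rewrite !mxE.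
move=> /andP[w0 w1] /andP[v0 v1].
have h1 : (v 0 j - w 0 j)%:~R < 1%:~R :> R by rewrite intrB; lra.
have h2 : (w 0 j - v 0 j)%:~R < 1%:~R :> R by rewrite intrB; lra.
by rewrite !ltr_int in h1 h2; lia.
Qed.

Let preim E v : set (borel R n) := [set y : 'rV[R]_n | E (y + intv v)].

Let measurable_preim E v : measurable E -> measurable (preim E v).
Proof.
move=> mE; apply: (@measurable_continuous_preimage _ n n (fun y => y + intv v)) => //.
apply: (@lipschitz_continuous _ _ _ 1) => y z.
by rewrite mul1r opprD addrACA subrr addr0.
Qed.

(** Countable additivity is stated for sequences, so lattice vectors are listed by [pickle]; codes
    of no vector give the empty set. *)
Let enum_rV (G : 'rV[int]_n -> set (borel R n)) (i : nat) : set (borel R n) :=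
  oapp G set0 (pickle_inv i).

Let enum_rVU G : \bigcup_i enum_rV G i = \bigcup_v G v.
Proof.
apply/seteqP; split => y [i _]; rewrite /enum_rV.
  by case: pickle_inv => //= v Gv; exists v.
by move=> Gi; exists (pickle i) => //; rewrite pickleK_inv.
Qed.

(** [E] is cut along the integer translates of the cell, and by periodicity each piece keeps its
    mass when moved back into [unit_cell]. *)
Lemma measure_fold E : measurable E ->
  mu E = (\sum_(i <oo) mu (enum_rV (fun v => preim E v `&` unit_cell) i))%E.
Proof.
move=> mE; pose G v : set (borel R n) := E `&` preim unit_cell (- v).
have mG v : measurable (G v).
  by apply: measurableI => //; apply: measurable_preim; exact: measurable_unit_cell.
rewrite [in LHS](_ : E = \bigcup_i enum_rV G i); last first.
  rewrite enum_rVU; apply/seteqP; split => [y Ey|y [v _ []//]].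
  have [v vy] := unit_cell_translate y; exists v => //; split => //.
  by rewrite /preim /= intvN.
rewrite measure_semi_bigcup.
- apply: eq_eseriesr => i _; rewrite /enum_rV; case: pickle_inv => [v|//] /=.
  rewrite -(@mu_periodic v); last exact: mG.
  congr (mu _); apply/seteqP; split => y; by rewrite /G /preim /= intvN addrK.
- by move=> i; rewrite /enum_rV; case: pickle_inv => [v|] /=.
- apply/trivIsetP => i j _ _ ij; rewrite /enum_rV.
  case Ei : (pickle_inv i) => [v|] /=; last by rewrite set0I.
  case Ej : (pickle_inv j) => [w|] /=; last by rewrite setI0.
  apply/seteqP; split => // y [[_ yv] [_ yw]].
  move: yv yw; rewrite /preim /= !intvN => yv yw.
  move/eqP: ij; apply.
  have := @pickle_invK 'rV[int]_n i; have := @pickle_invK 'rV[int]_n j.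
  by rewrite /ocancel Ei Ej /= => <- <-; rewrite (unit_cell_translate_inj yv yw).
- apply: bigcupT_measurable => i.
  by rewrite /enum_rV; case: pickle_inv => [v|] /=.
Qed.

Let measurable_fold_piece E i : measurable E ->
  measurable (enum_rV (fun v => preim E v `&` unit_cell) i).
Proof.
move=> mE; rewrite /enum_rV; case: pickle_inv => [v|] //=.
by apply: measurableI; [exact: measurable_preim|exact: measurable_unit_cell].
Qed.

Let translatesE E : translates E `&` unit_cell =
  \bigcup_i enum_rV (fun v => preim E v `&` unit_cell) i.
Proof.
rewrite enum_rVU; apply/seteqP; split => [y [[v Ev] yc]|y [v _ [Ev yc]]].
  by exists v.
by split => //; exists v.
Qed.

Lemma measurable_translates_cell E : measurable E ->
  measurable (translates E `&` unit_cell).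
Proof.
move=> mE; rewrite translatesE; apply: bigcupT_measurable => i.
exact: measurable_fold_piece.
Qed.

Lemma translates_cell_le E : measurable E -> (mu (translates E `&` unit_cell) <= mu E)%E.
Proof.
move=> mE; rewrite (measure_fold mE); apply: measure_sigma_subadditive.
- by move=> i; exact: measurable_fold_piece.
- exact: measurable_translates_cell.
- by rewrite translatesE.
Qed.

(** If [E] meets each class modulo Z^n at most once, the folded pieces are disjoint and the
    subadditivity behind [translates_cell_le] becomes additivity. *)
Lemma translates_cell_eq E : measurable E ->
  (forall y v w, E (y + intv v) -> E (y + intv w) -> v = w) ->
  mu (translates E `&` unit_cell) = mu E.
Proof.
move=> mE Einj; rewrite (measure_fold mE) translatesE measure_semi_bigcup//.
- by move=> i; exact: measurable_fold_piece.
- apply/trivIsetP => i j _ _ ij; rewrite /enum_rV.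
  case Ei : (pickle_inv i) => [v|] /=; last by rewrite set0I.
  case Ej : (pickle_inv j) => [w|] /=; last by rewrite setI0.
  apply/seteqP; split => // y [[yv _] [yw _]].
  move/eqP: ij; apply.
  have := @pickle_invK 'rV[int]_n i; have := @pickle_invK 'rV[int]_n j.
  by rewrite /ocancel Ei Ej /= => <- <-; rewrite (Einj _ _ _ yv yw).
- by apply: bigcupT_measurable => i; exact: measurable_fold_piece.
Qed.

Lemma ball_translate_inj x (t : R) y v w : 0 < t <= 1 / 2 ->
  ball x t (y + intv v) -> ball x t (y + intv w) -> v = w.
Proof.
move=> /andP[t0 t2] /(rV_ballP _ _ t0) vx /(rV_ballP _ _ t0) wx; apply/rowP => j.
have := vx j; have := wx j; rewrite !mxE !ltr_norml => /andP[w0 w1] /andP[v0 v1].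
have h1 : (v 0 j - w 0 j)%:~R < 1%:~R :> R by rewrite intrB; lra.
have h2 : (w 0 j - v 0 j)%:~R < 1%:~R :> R by rewrite intrB; lra.
by rewrite !ltr_int in h1 h2; lia.
Qed.

End periodic_measure.

(** * Concentration of the product kernel *)

Section torus_kernel.
Context {R : realType} {n : nat}.
Variables (m L : nat) (x : 'rV[R]_n).
Hypothesis L_gt0 : (0 < L)%N.

Lemma torus_kernel_ge0 y : 0 <= torus_kernel m L x y.
Proof. by apply: exprn_ge0; apply: prodr_ge0 => j _; exact: fejer_ge0. Qed.

Lemma torus_kernel_ge y (s : R) : s * (8 * L%:R) <= 1 ->
  translates (ball x s) y -> (1 / 2) ^+ (n * m) <= torus_kernel m L x y.
Proof.
move=> sL [v vy]; have s0 : 0 < s by case: vy.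
rewrite exprM /torus_kernel lerXn2r ?nnegrE ?exprn_ge0 ?prodr_ge0//.
  by move=> j _; exact: fejer_ge0.
rewrite -[n in leLHS]card_ord -prodr_const; apply: ler_prod => j _.
apply/andP; split; first by [].
rewrite -(fejerD_int _ _ (v 0 j)); apply: fejer_ge_half => //.
apply: le_trans sL; rewrite ler_wpM2r ?mulr_ge0//.
have := (rV_ballP _ _ s0).1 vy j; rewrite !mxE distrC => /ltW; apply: le_trans.
by rewrite addrAC.
Qed.

(** Subtracting nearest integers brings every coordinate difference into [[-1/2, 1/2]], where
    [fejer_le] applies. One of them still has size at least [t]; its factor alone gives the bound,
    the others being at most [1]. *)
Lemma torus_kernel_le y (t : R) : 0 < t -> ~ translates (ball x t) y ->
  torus_kernel m L x y <= (8 / (L%:R * t) ^+ 2) ^+ m.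
Proof.
move=> t0 yt.
pose v : 'rV[int]_n := \row_j - Num.floor (y 0 j - x 0 j + 1 / 2).
have vj j : `|y 0 j - x 0 j + (v 0 j)%:~R| <= 1 / 2.
  by rewrite mxE norm_sub_round.
have [j jt] : exists j, t <= `|y 0 j - x 0 j + (v 0 j)%:~R|.
  apply: contrapT => /forallNP h; apply: yt; exists v; apply/rV_ballP => // j.
  have /negP := h j; rewrite -ltNge distrC; congr (_ < _); congr `|_|.
  by rewrite !mxE; ring.
rewrite /torus_kernel lerXn2r ?nnegrE ?divr_ge0 ?sqr_ge0 ?prodr_ge0//.
  by move=> i _; exact: fejer_ge0.
apply: (@le_trans _ _ (fejer L (y 0 j - x 0 j))).
  rewrite (bigD1 j)//= ler_piMr ?fejer_ge0//.
  by apply: prodr_ile1 => i _; rewrite fejer_ge0 fejer_le1.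
rewrite -(fejerD_int _ _ (v 0 j)); apply: le_trans (fejer_le _ _ _) _ => //.
  by rewrite -normr_gt0 (lt_le_trans t0).
have Lp : 0 < L%:R :> R by rewrite ltr0n.
rewrite ler_wpM2l// lef_pV2 ?posrE ?exprn_gt0 ?mulr_gt0// ?(lt_le_trans t0)//.
have : L%:R * t <= L%:R * `|y 0 j - x 0 j + (v 0 j)%:~R| by rewrite ler_pM2l.
by apply: lerXn2r; rewrite nnegrE mulr_ge0// ltW.
Qed.
End torus_kernel.

Lemma translates_ball_large {R : realType} n (x y : 'rV[R]_n) (t : R) :
  1 / 2 < t -> translates (ball x t) y.
Proof.
move=> t2; exists (\row_j - Num.floor (y 0 j - x 0 j + 1 / 2)).
apply/rV_ballP => [|j]; first by lra.
by rewrite distrC !mxE addrAC (le_lt_trans (norm_sub_round _)).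
Qed.

Lemma measurable_ball_rV {R : realType} n (x : 'rV[R]_n) (t : R) :
  measurable (ball x t : set (borel R n)).
Proof. by apply: open_measurable_borel; exact: ball_open. Qed.

Section cone_gap.
Context {R : realType} {n : nat} (C : set 'rV[R]_n).
Hypotheses (C_cone : is_cone C) (C_closed : closed C).

(** A ball around [xi] that misses [C] and [- C] grows under dilation: at distance [N] along the ray
    the clearance is [N * delta], hence room for a bandwidth proportional to [N]. *)
Lemma cone_gap (xi : 'rV[R]_n) : ~ C xi -> ~ C (- xi) ->
  exists2 delta : R, 0 < delta &
    forall (N : R) (k : 'rV[R]_n), 0 < N -> `|k - N *: xi| < N * delta ->
      ~ (C (- k) \/ C k).
Proof.
move=> Cxi CNxi.
have gap z : ~ C z -> exists2 e : R, 0 < e & forall w, `|z - w| < e -> ~ C w.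
  move=> Cz; have : nbhs z (~` C) by apply: open_nbhs_nbhs; split => //; exact: closed_openC.
  move=> /nbhs_ballP[e /= e0 eC]; exists e => // w zw; apply: eC.
  by rewrite -ball_normE.
have [d1 d10 d1P] := gap _ Cxi; have [d2 d20 d2P] := gap _ CNxi.
exists (Num.min d1 d2); first by rewrite lt_min d10.
move=> N k N0 kN.
have kN' : `|xi - N^-1 *: k| < Num.min d1 d2.
  rewrite -(ltr_pM2l N0); apply: le_lt_trans kN.
  rewrite -{1}(gtr0_norm N0) -normrZ scalerBr scalerA divff ?gt_eqF// scale1r.
  by rewrite distrC.
move: kN'; rewrite lt_min => /andP[h1 h2].
have Ni : 0 < N^-1 by rewrite invr_gt0.
case=> /(C_cone _ Ni); last exact: d1P.
by apply: d2P; rewrite scalerN -opprD normrN.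
Qed.
End cone_gap.

(** * Masses of balls on the torus *)

Section mass.
Context {R : realType} {n : nat} (mu : {measure set (borel R n) -> \bar R}).
Hypotheses (mu_radon : radon mu) (mu_periodic : Defs.periodic mu).

Definition cell_mass (A : set (borel R n)) : R := fine (mu (A `&` unit_cell)).

Let cell_fin (A : set (borel R n)) : measurable (A `&` unit_cell) ->
  mu (A `&` unit_cell) \is a fin_num.
Proof.
move=> mA; rewrite ge0_fin_numE//; apply: le_lt_trans (unit_cell_fin mu_radon).
by apply: le_measure; rewrite ?inE//; exact: measurable_unit_cell.
Qed.

Lemma measurable_translates_ball x t :
  measurable (translates (ball x t : set (borel R n)) `&` unit_cell).
Proof. by apply: measurable_translates_cell; exact: measurable_ball_rV. Qed.

(** The shells run up to radii beyond [t0], so the local bound has to hold for every radius. For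
    [t >= t0] the finite mass [m0] of the cell is at most [m0 / t0 ^+ d * t ^+ d]. *)
Lemma cell_mass_ball_le x (d : nat) (c t0 : R) : 0 < t0 ->
  (forall t, 0 < t -> t < t0 -> (mu (ball x t) <= (c * t ^+ d)%:E)%E) ->
  exists2 c' : R, 0 < c' &
    forall t, 0 < t -> cell_mass (translates (ball x t)) <= c' * t ^+ d.
Proof.
move=> t00 cP; pose m0 := fine (mu unit_cell).
have m0_ge0 : 0 <= m0 by apply: fine_ge0.
have t0d : 0 < t0 ^+ d by rewrite exprn_gt0.
exists (`|c| + m0 / t0 ^+ d + 1); first by rewrite ltr_wpDl// addr_ge0// divr_ge0// ltW.
move=> t tpos; have td : 0 < t ^+ d by rewrite exprn_gt0.
have [tt0|t0t] := ltP t t0.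
  apply: (@le_trans _ _ (c * t ^+ d)); last first.
    rewrite ler_wpM2r// ?(ltW td)//; have := ler_norm c.
    have : 0 <= m0 / t0 ^+ d by rewrite divr_ge0// ltW.
    lra.
  rewrite -lee_fin /cell_mass fineK; last by apply: cell_fin; exact: measurable_translates_ball.
  apply: le_trans (cP _ tpos tt0).
  by apply: translates_cell_le => //; exact: measurable_ball_rV.
apply: (@le_trans _ _ (m0 / t0 ^+ d * t ^+ d)); last first.
  by rewrite ler_wpM2r// ?(ltW td)//; have := normr_ge0 c; lra.
apply: (@le_trans _ _ m0).
  apply: fine_le.
  - by apply: cell_fin; exact: measurable_translates_ball.
  - by rewrite ge0_fin_numE//; exact: unit_cell_fin.
  - apply: le_measure; rewrite ?inE//; first exact: measurable_translates_ball.
    exact: measurable_unit_cell.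
rewrite mulrAC ler_pdivlMr// ler_wpM2l//.
by apply: lerXn2r; rewrite ?nnegrE// ltW.
Qed.

Lemma cell_mass_ball_ge x (d : nat) (c t : R) : 0 < t <= 1 / 2 ->
  ((c * t ^+ d)%:E <= mu (ball x t))%E ->
  c * t ^+ d <= cell_mass (translates (ball x t)).
Proof.
move=> t2 cP; rewrite -lee_fin /cell_mass fineK.
  rewrite translates_cell_eq//; first exact: measurable_ball_rV.
  by move=> y v w; exact: ball_translate_inj.
by apply: cell_fin; exact: measurable_translates_ball.
Qed.

Lemma indic_cell_integrable (A : set (borel R n)) : measurable (A `&` unit_cell) ->
  mu.-integrable unit_cell (EFin \o (\1_(A `&` unit_cell) : borel R n -> R)).
Proof.
move=> mA; apply: measurable_bounded_integrable.
- exact: measurable_unit_cell.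
- exact: unit_cell_fin.
- exact: measurable_indic.
- exists 1; split => // y y1 x _; apply: le_trans (ltW y1).
  by rewrite indicE; case: (_ \in _); rewrite ?normr0 ?normr1.
Qed.

Lemma Rintegral_indic_cell (A : set (borel R n)) : measurable (A `&` unit_cell) ->
  \int[mu]_(y in unit_cell) \1_(A `&` unit_cell) y = cell_mass A.
Proof.
move=> mA; rewrite /Rintegral integral_indic//; last exact: measurable_unit_cell.
by rewrite -setIA setIid.
Qed.

(** Integrates a pointwise bound in which [g] and the null set [Z] contribute nothing. The
    coefficient [2] is for the points of [Z], where only [g >= -1] and [a <= 1] will be known. *)
Lemma cell_mass_sum_ge (a : R) (A Z : set (borel R n)) (I : nat) (b : nat -> R)
    (B : nat -> set (borel R n)) (g : 'rV[R]_n -> R) : continuous g ->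
  measurable (A `&` unit_cell) -> measurable (Z `&` unit_cell) ->
  (forall i, measurable (B i `&` unit_cell)) ->
  \int[mu]_(y in unit_cell) g y = 0 -> mu (Z `&` unit_cell) = 0%E ->
  (forall y, unit_cell y -> a * \1_(A `&` unit_cell) y <=
     g y + \sum_(i < I) b i * \1_(B i `&` unit_cell) y + 2 * \1_(Z `&` unit_cell) y) ->
  a * cell_mass A <= \sum_(i < I) b i * cell_mass (B i).
Proof.
move=> cg mA mZ mB g0 Z0 H.
have mc := @measurable_unit_cell R n.
have iA c D : measurable (D `&` unit_cell) -> mu.-integrable unit_cell
    (EFin \o ((fun y => c * \1_(D `&` unit_cell) y) : borel R n -> R)).
  by move=> mD; have := integrableZl mc c (indic_cell_integrable mD).
have RA c D : measurable (D `&` unit_cell) ->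
    \int[mu]_(y in unit_cell) (c * \1_(D `&` unit_cell) y) = c * cell_mass D.
  by move=> mD; rewrite RintegralZl ?Rintegral_indic_cell//; exact: indic_cell_integrable.
have ig := cell_integrable mu_radon cg.
have [iS RS] : mu.-integrable unit_cell (EFin \o ((fun y =>
      \sum_(i < I) b i * \1_(B i `&` unit_cell) y) : borel R n -> R)) /\
    \int[mu]_(y in unit_cell) (\sum_(i < I) b i * \1_(B i `&` unit_cell) y) =
    \sum_(i < I) b i * cell_mass (B i).
  elim: (I) => [|J [IH1 IH2]].
    split.
      under eq_fun do rewrite big_ord0; exact: integrable0.
    rewrite big_ord0 /Rintegral.
    by under eq_integral do rewrite big_ord0; rewrite integral0.
  split.
    under eq_fun do rewrite big_ord_recr /=.
    exact: (integrableD mc IH1 (iA _ _ (mB J))).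
  rewrite big_ord_recr/= -IH2 -RA// -RintegralD//; last exact: iA.
  by apply: eq_Rintegral => y _; rewrite big_ord_recr.
have iGS := integrableD mc ig iS.
have -> : \sum_(i < I) b i * cell_mass (B i) = \int[mu]_(y in unit_cell)
    (g y + \sum_(i < I) b i * \1_(B i `&` unit_cell) y + 2 * \1_(Z `&` unit_cell) y).
  rewrite RintegralD//; last exact: iA.
  by rewrite RintegralD// g0 RS RA// /cell_mass Z0 mulr0 add0r addr0.
rewrite -RA//; apply: le_Rintegral => //; first exact: iA.
exact: (integrableD mc iGS (iA _ _ mZ)).
Qed.
End mass.

(** * Blow-up at a point *)

(** With [X = 2 ^+ i * R0], kernel decay times mass is a constant times [X ^- d.+2 / L ^+ d].
    Keeping only [X^-1] leaves a geometric series of ratio [1 / 2] and a gain [1 / R0], the free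
    parameter that later beats the other constants. *)
Lemma shell_sum_le {R : realType} (d : nat) (c R0 : R) (L I : nat) : 0 < c -> 1 <= R0 -> (0 < L)%N ->
  \sum_(i < I) (8 / (L%:R * (2 ^+ i * R0 / L%:R)) ^+ 2) ^+ d.+1 *
     (c * (2 ^+ i.+1 * R0 / L%:R) ^+ d)
  <= 2 * (8 ^+ d.+1 * 2 ^+ d * c) / R0 / L%:R ^+ d.
Proof.
move=> c0 R01 L0.
have Lp : 0 < L%:R :> R by rewrite ltr0n.
have R0p : 0 < R0 by lra.
set K := 8 ^+ d.+1 * 2 ^+ d * c.
have K0 : 0 < K by rewrite !mulr_gt0.
have term (i : nat) : (8 / (L%:R * (2 ^+ i * R0 / L%:R)) ^+ 2) ^+ d.+1 *
     (c * (2 ^+ i.+1 * R0 / L%:R) ^+ d) <= K / R0 / L%:R ^+ d * (2^-1) ^+ i.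
  set X := 2 ^+ i * R0.
  have X1 : 1 <= X by rewrite -[1]mulr1 ler_pM// exprn_ege1// ler1n.
  have X0 : 0 < X by lra.
  rewrite (_ : L%:R * (X / L%:R) = X); last by field; rewrite gt_eqF.
  rewrite (_ : 2 ^+ i.+1 * R0 = 2 * X); last by rewrite exprS mulrA.
  have -> : (8 / X ^+ 2) ^+ d.+1 * (c * (2 * X / L%:R) ^+ d) =
     K / L%:R ^+ d * (X ^- d.+2).
    have -> : X ^+ d.+2 = (X ^+ 2) ^+ d.+1 / X ^+ d.
      rewrite -exprM (_ : 2 * d.+1 = d.+2 + d)%N; last by lia.
      by rewrite exprD mulfK// expf_neq0 ?gt_eqF.
    rewrite !expr_div_n [(2 * X) ^+ d]exprMn /K.
    have : X ^+ 2 ^+ d.+1 != 0 by rewrite !expf_neq0 ?gt_eqF.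
    have : X ^+ d != 0 by rewrite !expf_neq0 ?gt_eqF.
    have : L%:R ^+ d != 0 :> R by rewrite !expf_neq0 ?gt_eqF.
    move: (X ^+ 2 ^+ d.+1) (X ^+ d) (L%:R ^+ d) (8 ^+ d.+1) (2 ^+ d) => ? ? ? ? ? h1 h2 h3.
    by field; rewrite ?h1 ?h2 ?h3.
  rewrite [leRHS](_ : _ = K / L%:R ^+ d * X^-1); last first.
    have hi : 2 ^+ i != 0 :> R by rewrite expf_neq0.
    have hL : L%:R ^+ d != 0 :> R by rewrite !expf_neq0 ?gt_eqF.
    rewrite /X exprVn; move: (2 ^+ i) (L%:R ^+ d) hi hL => ? ? h1 h2.
    by field; rewrite ?h1 ?h2 ?gt_eqF.
  rewrite ler_wpM2l//; first by rewrite divr_ge0 ?exprn_ge0// ltW.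
  rewrite lef_pV2 ?posrE ?exprn_gt0// exprS ler_peMr ?(ltW X0)//.
  exact: exprn_ege1.
apply: (@le_trans _ _ (\sum_(i < I) K / R0 / L%:R ^+ d * (2^-1) ^+ i)).
  by apply: ler_sum => i _; exact: term.
rewrite -mulr_sumr [leRHS](_ : _ = K / R0 / L%:R ^+ d * 2); last by ring.
rewrite ler_wpM2l//; first by rewrite !divr_ge0 ?exprn_ge0// ltW.
suff -> : \sum_(i < I) (2^-1 : R) ^+ i = 2 - 2 * (2^-1) ^+ I.
  by rewrite gerBl mulr_ge0// exprn_ge0// invr_ge0.
elim: (I) => [|J IH]; first by rewrite big_ord0 expr0; ring.
by rewrite big_ord_recr/= IH exprS; field.
Qed.

Lemma measurable_off_cone {R : realType} n (x xi : 'rV[R]_n) (eta t : R) :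
  measurable (ball x t `&` [set z : 'rV[R]_n |
    eta * `|z - x| < `|dot xi (z - x)|] : set (borel R n)).
Proof.
set off_cone := (X in _ `&` X).
apply: measurableI; first exact: measurable_ball_rV.
apply: open_measurable_borel.
have cf : continuous (fun z : 'rV[R]_n => `|dot xi (z - x)| - eta * `|z - x|).
  have cB : continuous (fun z : 'rV[R]_n => z - x).
    apply: (@lipschitz_continuous _ _ _ 1) => y z.
    by rewrite mul1r opprB addrA subrK.
  have cd : continuous (fun z : 'rV[R]_n => dot xi (z - x)).
    move=> z; apply: (@continuous_comp _ _ _ (fun z : 'rV[R]_n => z - x) (dot xi)).
      exact: cB.
    exact: dot_continuous.
  move=> z; exact: (cvgB (cvg_norm (cd z)) (cvgM (cvg_cst eta) (cvg_norm (cB z)))).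
rewrite (_ : off_cone = (fun z : 'rV[R]_n => `|dot xi (z - x)| - eta * `|z - x|) @^-1` [set u | 0 < u]).
  by apply: open_comp => [z _|]; [exact: cf|exact: open_gt].
by apply/seteqP; split => z; rewrite /off_cone /= subr_gt0.
Qed.

Section blowup.
Context {R : realType} {n : nat} (mu : {measure set (borel R n) -> \bar R}).
Variable C : set 'rV[R]_n.
Hypotheses (mu_radon : radon mu) (mu_periodic : Defs.periodic mu).
Hypotheses (C_cone : is_cone C) (C_closed : closed C).
Hypothesis mu_spectrum : forall k, fourier_supp mu k -> C (- intv k) \/ C (intv k).
Variables (d : nat) (x xi : 'rV[R]_n) (c1 c2 t0 : R).
Hypotheses (c1_gt0 : 0 < c1) (t0_gt0 : 0 < t0).
Hypothesis mass_ge : forall t, 0 < t -> t < t0 ->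
  ((c1 * t ^+ d)%:E <= mu (ball x t))%E.
Hypothesis mass_le : forall t, 0 < t -> t < t0 ->
  (mu (ball x t) <= (c2 * t ^+ d)%:E)%E.

Let off_cone (eta : R) : set (borel R n) :=
  [set z : 'rV[R]_n | eta * `|z - x| < `|dot xi (z - x)|].

Hypothesis mass_tangent : forall eta, 0 < eta ->
  exists2 t1 : R, 0 < t1 & mu (ball x t1 `&` off_cone eta) = 0%E.

(** The bandwidth and the clearance around [k0] both grow linearly in [L], so one [p] serves all
    [L]. *)
Lemma spectrum_vanish : ~ C xi -> ~ C (- xi) -> exists2 p : nat, (0 < p)%N &
  forall L : nat, (0 < L)%N -> exists2 k0 : 'rV[int]_n,
    `|intv k0 - (p%:R * L%:R) *: xi| <= 1 &
    forall k : 'rV[int]_n, (forall j, `|k 0 j - k0 0 j| <= (d.+1 * (n * L))%:Z) ->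
      fourier_coef mu k = 0.
Proof.
move=> Cxi CNxi; have [delta delta0 deltaP] := cone_gap C_cone C_closed Cxi CNxi.
(* [d.+1 * n] pays for the bandwidth. The added [2] pays for the rounding error [1] of [k0] with a
   strict inequality even when [L = 1]. *)
pose q := (d.+1 * n).+2.
have [p] : exists p : nat, q%:R < p%:R * delta.
  exists (Num.trunc (q%:R / delta)).+1; rewrite -ltr_pdivrMr//.
  exact: truncnS_gt.
case: p => [|p] pq; first by move: pq; rewrite mul0r ltrn0.
exists p.+1 => // L L0.
pose N : R := p.+1%:R * L%:R.
have N0 : 0 < N by rewrite mulr_gt0// ltr0n.
pose k0 : 'rV[int]_n := \row_j Num.floor (N * xi 0 j).
have k0N : `|intv k0 - N *: xi| <= 1.
  apply: mx_norm_le => // i j; rewrite !mxE ord1.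
  have f1 := floor_le (N * xi 0 j); have f2 := lt_succ_floor (N * xi 0 j).
  by rewrite intrD in f2; rewrite ler_norml; apply/andP; split; lra.
exists k0 => // k kk0; apply: contrapT => /eqP kS.
have := mu_spectrum kS; apply: (deltaP N) => //.
rewrite -(subrK (intv k0) (intv k)) -addrA.
apply: le_lt_trans (ler_normD _ _) _.
apply: (@le_lt_trans _ _ ((d.+1 * (n * L))%:R + 1)).
  apply: lerD => //; apply: mx_norm_le => // i j; rewrite ord1 !mxE -intrB -intr_norm.
  by have := kk0 j; rewrite mxE -(ler_int R).
apply: (@lt_le_trans _ _ (q%:R * L%:R)).
  rewrite natr1 -natrM ltr_nat /q mulnA; move: (d.+1 * n)%N => u.
  by rewrite !mulSn; lia.
by rewrite /N mulrAC ler_wpM2r// ltW.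
Qed.

Lemma blowup_spectrum : C xi \/ C (- xi).
Proof.
apply: contrapT => /not_orP[Cxi CNxi].
have [p p0 pP] := spectrum_vanish Cxi CNxi.
have [c2' c20 mle] := cell_mass_ball_le mu_radon mu_periodic t0_gt0 mass_le.
(* With this power the kernel decays like [r ^- (2 * d + 2)], which beats the
   mass [r ^+ d] of the shells. *)
pose m := d.+1.
(* The lower bound of [g] on the peak: [1 / 2] from the cosine, [(1 / 2) ^+ (n * m)] from the
   kernel. *)
pose a : R := 1 / 2 * (1 / 2) ^+ (n * m).
have a0 : 0 < a by rewrite mulr_gt0 ?exprn_gt0//; lra.
have a1 : a <= 1.
  have : (1 / 2 : R) ^+ (n * m) <= 1 by rewrite exprn_ile1//; lra.
  rewrite /a; lra.
pose K : R := 2 * (8 ^+ d.+1 * 2 ^+ d * c2').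
have K0 : 0 < K by rewrite !mulr_gt0 ?exprn_gt0.
(* Makes the shell bound [K / R0] smaller than [a * c1 / 8 ^+ d], the constant of the peak; [8 ^+ d]
   comes from the radius [s] below. *)
pose R0 : R := 1 + K * 8 ^+ d / (a * c1).
have R01 : 1 <= R0 by rewrite lerDl divr_ge0 ?mulr_ge0 ?exprn_ge0 ?ltW.
have R00 : 0 < R0 by lra.
have pp : 0 < p%:R :> R by rewrite ltr0n.
(* Then [p L * eta * (R0 / L) = 1 / 16]: this bounds the contribution of [xi] to [<k0, y - x>] on
   the central ball, near [M]. *)
pose eta := 1 / (16 * p%:R * R0).
have eta0 : 0 < eta by rewrite divr_gt0// !mulr_gt0.
have [t1 t10 null] := mass_tangent eta0.
(* The central radius [R0 / L] must lie below [t1], the peak radius [1 / (8 L)] below [t0], and the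
   rounding of [k0] may add at most [n R0 / L <= 1 / 16] to [<k0, y - x>]. *)
have [L] : exists L : nat, [&& (0 < L)%N, R0 < t1 * L%:R, 1 < t0 * (8 * L%:R) & 16 * n%:R * R0 <= L%:R].
  pose M := R0 / t1 + 1 / t0 + 16 * n%:R * R0.
  exists (Num.trunc M).+1.
  have ML : M < (Num.trunc M).+1%:R by exact: truncnS_gt.
  have h1 : 0 <= R0 / t1 by rewrite divr_ge0// ltW.
  have h2 : 0 <= 1 / t0 by rewrite divr_ge0// ltW.
  have h3 : 0 <= 16 * n%:R * R0 by rewrite !mulr_ge0// ltW.
  rewrite /= mulrC -ltr_pdivrMr// (mulrC t0) -ltr_pdivrMr//; rewrite /M in ML.
  by apply/and3P; split; lra.
case/and4P => L0 LR0 Lt0 LnR0.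
have Lp : 0 < L%:R :> R by rewrite ltr0n.
have [k0 k0xi k0P] := pP _ L0.
pose s : R := 1 / (8 * L%:R).
have s0 : 0 < s by rewrite divr_gt0// mulr_gt0.
have L1 : 1 <= L%:R :> R by rewrite ler1n.
have s8 : s * (8 * L%:R) = 1 by rewrite /s mul1r mulVf// gt_eqF// mulr_gt0.
have s2 : s <= 1 / 2 by rewrite /s ler_pdivrMr ?mulr_gt0//; lra.
have st0 : s < t0 by rewrite /s ltr_pdivrMr ?mulr_gt0.
pose T (t : R) : set (borel R n) := translates (ball x t).
pose t_ i : R := 2 ^+ i * R0 / L%:R.
have t_gt0 i : 0 < t_ i by rewrite divr_gt0// mulr_gt0// exprn_gt0.
pose b i : R := (8 / (L%:R * t_ i) ^+ 2) ^+ m.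
have b0 i : 0 <= b i by rewrite exprn_ge0// divr_ge0// sqr_ge0.
(* This phase centres the cosine at [x]. *)
pose phi : R := - (2 * pi * dot (intv k0) x).
pose g y : R := cos (2 * pi * dot (intv k0) y + phi) * torus_kernel m L x y.
have [cK KP] := @band_limited_kernel R n mu mu_radon m L x.
have cg : continuous g by apply: continuousMf => //; exact: cos_mode_continuous.
have g0 : \int[mu]_(y in unit_cell) g y = 0 by exact: KP.
pose Z : set (borel R n) := translates (ball x t1 `&` off_cone eta).
have Z0 : mu (Z `&` unit_cell) = 0%E.
  apply/eqP; rewrite eq_le measure_ge0 andbT -null.
  by apply: translates_cell_le => //; exact: measurable_off_cone.
have TS t t' : t <= t' -> T t `<=` T t'.
  by move=> tt' y [v yv]; exists v; apply: (le_ball tt').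
have gN y : - torus_kernel m L x y <= g y.
  rewrite /g -[leLHS]mulN1r ler_wpM2r//; last exact: cos_geN1.
  exact: torus_kernel_ge0.
have K1 y : torus_kernel m L x y <= 1.
  apply: exprn_ile1; first by apply: prodr_ge0 => j _; exact: fejer_ge0.
  by apply: prodr_ile1 => j _; rewrite fejer_ge0 fejer_le1.
have cos_half y : T (t_ 0%N) y -> ~ Z y -> 1 / 2 <= cos (2 * pi * dot (intv k0) y + phi).
  move=> [v yv] Zy; pose z := y + intv v.
  have zx : `|z - x| < R0 / L%:R.
    by move: yv; rewrite /t_ expr0 mul1r -ball_normE /ball_/= distrC.
  have zt1 : ball x t1 z.
    rewrite -ball_normE /= distrC; apply: lt_trans zx _.
    by rewrite ltr_pdivrMr.
  have zeta : `|dot xi (z - x)| <= eta * `|z - x|.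
    by rewrite leNgt; apply/negP => h; apply: Zy; exists v; split.
  (* [<k0, v>] is an integer, so [y] may be replaced by its translate [z] close to [x]. The two
     errors [1 / 16] then give [|<k0, z - x>| <= 1 / 8], and [2 pi / 8 < 1]. *)
  rewrite -(cosD_int _ (\sum_j k0 0 j * v 0 j)) -dot_intv.
  rewrite (_ : 2 * pi * dot (intv k0) y + phi + _ =
      2 * pi * dot (intv k0) (z - x)); last first.
    by rewrite /phi /z dotBr dotDr; ring.
  apply: cos_ge_half.
  have -> : dot (intv k0) (z - x) = p%:R * L%:R * dot xi (z - x) +
      dot (intv k0 - (p%:R * L%:R) *: xi) (z - x).
    by rewrite dotDl dotNl dotZl; ring.
  have e1 : p%:R * L%:R * `|dot xi (z - x)| <= 1 / 16.
    apply: (@le_trans _ _ (p%:R * L%:R * (eta * (R0 / L%:R)))).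
      rewrite ler_wpM2l ?mulr_ge0// (le_trans zeta)// ler_wpM2l// ltW//.
    by rewrite /eta le_eqVlt; apply/orP; left; apply/eqP; field; rewrite !gt_eqF.
  have e2 : `|dot (intv k0 - (p%:R * L%:R) *: xi) (z - x)| <= 1 / 16.
    apply: le_trans (dot_norm_le _ _) _.
    apply: (@le_trans _ _ (n%:R * 1 * (R0 / L%:R))).
      by apply: ler_pM; rewrite ?mulr_ge0 ?ler_wpM2l// ltW.
    by rewrite mulr1 mulrA ler_pdivrMr//; lra.
  have e3 : `|p%:R * L%:R * dot xi (z - x) + dot (intv k0 - (p%:R * L%:R) *: xi) (z - x)| <= 1 / 8.
    apply: le_trans (ler_normD _ _) _.
    by rewrite normrM (ger0_norm (_ : 0 <= p%:R * L%:R)) ?mulr_ge0//; lra.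
  have pi4 := @pihalf_lt2 R; have pi0 := @pi_gt0 R.
  rewrite normrM ger0_norm; last by rewrite mulr_ge0// ltW.
  apply: (@le_trans _ _ (2 * 4 * (1 / 8))); last by lra.
  by apply: ler_pM => //; lra.
(* [torus_kernel] is small off [T (t_ 0)], at most [b i] on the shell between
   [T (t_ i)] and [T (t_ i.+1)], and [T (t_ L)] is the whole space. *)
have key y : unit_cell y -> a * \1_(T s `&` unit_cell) y <=
    g y + \sum_(i < L) b i * \1_(T (t_ i.+1) `&` unit_cell) y + 2 * \1_(Z `&` unit_cell) y.
  move=> yc; have inE D : \1_(D `&` unit_cell) y = (y \in D)%:R :> R.
    by rewrite indicE in_setI (mem_set yc) andbT.
  rewrite !inE; under eq_bigr do rewrite inE.
  have S0 : 0 <= \sum_(i < L) b i * (y \in T (t_ i.+1))%:R.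
    by apply: sumr_ge0 => i _; rewrite mulr_ge0.
  have aT : a * (y \in T s)%:R <= a by rewrite ler_piMr// ?(ltW a0)//; case: (_ \in _).
  have gy := gN y; have Ky := K1 y; have Ky0 := @torus_kernel_ge0 R n m L x y.
  have [Zy|Zy] := pselect (Z y).
    by rewrite [y \in Z]mem_set// mulr1; lra.
  rewrite [y \in Z]memNset// mulr0 addr0.
  have st : s <= t_ 0%N.
    by rewrite /t_ expr0 mul1r ler_pdivlMr//; move: s8; rewrite mulrCA; lra.
  have [Ty|Ty] := pselect (T (t_ 0%N) y).
    have ch := cos_half _ Ty Zy.
    have gk : 1 / 2 * torus_kernel m L x y <= g y by rewrite /g ler_wpM2r.
    have [Tsy|Tsy] := pselect (T s y); last first.
      by rewrite [y \in T s]memNset// mulr0; lra.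
    rewrite [y \in T s]mem_set// mulr1.
    have := @torus_kernel_ge R n m L x L0 y s _ Tsy; rewrite s8 => /(_ (lexx _)) kg.
    have : a <= 1 / 2 * torus_kernel m L x y by rewrite /a ler_wpM2l.
    lra.
  rewrite [y \in T s]memNset ?mulr0; last by move=> /(TS _ _ st).
  have TL : T (t_ L) y.
    apply: translates_ball_large; rewrite /t_ ltr_pdivlMr//.
    have : (L%:R : R) <= 2 ^+ L by rewrite -natrX ler_nat ltnW// ltn_expl.
    have : 2 ^+ L <= 2 ^+ L * R0 by rewrite ler_peMr// exprn_ge0.
    lra.
  have [i iL [Ti TiS]] : exists2 i, (i < L)%N & ~ T (t_ i) y /\ T (t_ i.+1) y.
    elim: (L) TL => [//|J IH] TJ; have [TJ'|TJ'] := pselect (T (t_ J) y).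
      by have [i iJ iP] := IH TJ'; exists i => //; exact: ltnW.
    by exists J.
  have kb := @torus_kernel_le R n m L x L0 y _ (t_gt0 i) Ti.
  have : b i <= \sum_(i < L) b i * (y \in T (t_ i.+1))%:R.
    rewrite (bigD1 (Ordinal iL))//= [y \in T _]mem_set// mulr1 lerDl.
    by apply: sumr_ge0 => j _; rewrite mulr_ge0.
  rewrite -/(b i) in kb; lra.
have := @cell_mass_sum_ge R n mu mu_radon a (T s) Z L b (fun i => T (t_ i.+1)) g cg.
have mT t : measurable (T t `&` unit_cell) by exact: measurable_translates_ball.
move=> /(_ (mT _) _ (fun i => mT _) g0 Z0 key).
have mZ : measurable (Z `&` unit_cell).
  by apply: measurable_translates_cell; exact: measurable_off_cone.
move=> /(_ mZ).
have lower : c1 * s ^+ d <= cell_mass mu (T s).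
  by apply: cell_mass_ball_ge => //; [rewrite s0|exact: mass_ge].
have upper : \sum_(i < L) b i * cell_mass mu (T (t_ i.+1)) <= K / R0 / L%:R ^+ d.
  apply: le_trans (@shell_sum_le R d c2' R0 L L c20 R01 L0).
  by apply: ler_sum => i _; rewrite ler_wpM2l// mle.
move=> /le_trans /(_ upper) contra.
have : a * (c1 * s ^+ d) <= K / R0 / L%:R ^+ d.
  by apply: le_trans contra; rewrite ler_wpM2l// ltW.
rewrite leNgt => /negP; apply.
(* Peak and shells both scale like [L ^- d]; the factor cancels and the choice of [R0] decides. *)
have Ld : 0 < L%:R ^+ d :> R by rewrite exprn_gt0.
rewrite ltr_pdivrMr// ltr_pdivrMr//.
rewrite (_ : _ * R0 = a * c1 / 8 ^+ d * R0); last first.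
  rewrite /s expr_div_n expr1n exprMn; field.
  by rewrite !expf_neq0// gt_eqF.
have ac : 0 < a * c1 by rewrite mulr_gt0.
rewrite mulrAC ltr_pdivlMr ?exprn_gt0// /R0 mulrDr mulr1 mulrC.
rewrite [X in _ < _ + X](_ : _ = K * 8 ^+ d); last by field; rewrite gt_eqF// mulf_neq0 // gt_eqF.
by rewrite mulrC ltrDr.
Qed.

End blowup.

(** * Local geometry of a graph *)

Section graph.
Context {R : realType}.

(** [A] and [B] are the first [d] and the last [c] rows of the rotation. Working with them removes
    the cast along [d + c = n]: [A^T] reads off the chart coordinate and [B^T] the height. *)
Record graph_frame n d c (A : 'M[R]_(d, n)) (B : 'M[R]_(c, n)) : Prop := {
  frameAA : A *m A^T = 1%:M ; frameAB : A *m B^T = 0 ; frameBA : B *m A^T = 0 ;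
  frameBB : B *m B^T = 1%:M ; frame_id : A^T *m A + B^T *m B = 1%:M }.

Lemma graph_map_frame n d c (E : (d + c)%N = n) (Q : 'M[R]_n) : is_rotation Q ->
  exists (A : 'M[R]_(d, n)) (B : 'M[R]_(c, n)), graph_frame A B /\
    forall (f : 'rV[R]_d -> 'rV[R]_c) u, graph_map E Q f u = u *m A + f u *m B.
Proof.
subst n; move=> [QQ _]; have QQ' : Q^T *m Q = 1%:M by exact: mulmx1C.
pose P1 : 'M[R]_(d, d + c) := row_mx 1%:M 0.
pose P2 : 'M[R]_(c, d + c) := row_mx 0 1%:M.
have PQ m p (X : 'M[R]_(m, d + c)) (Y : 'M[R]_(p, d + c)) :
    (X *m Q) *m (Y *m Q)^T = X *m Y^T.
  by rewrite trmx_mul mulmxA -(mulmxA X) QQ mulmx1.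
exists (P1 *m Q), (P2 *m Q); split; last first.
  move=> f u; rewrite /graph_map castmx_id !mulmxA -mulmxDl; congr (_ *m _).
  by rewrite !mul_mx_row !mulmx1 !mulmx0 add_row_mx addr0 add0r.
have [t1 t2] : P1^T = col_mx 1%:M 0 /\ P2^T = col_mx 0 1%:M.
  by rewrite !tr_row_mx !trmx1 !trmx0.
split; rewrite ?PQ ?t1 ?t2 ?mul_row_col ?mulmx1 ?mulmx0 ?mul0mx ?addr0 ?add0r//.
rewrite !trmx_mul t1 t2 !mulmxA -!(mulmxA Q^T) -mulmxDr -mulmxDl !mul_col_row.
rewrite !(mulmx1, mulmx0, mul0mx) add_block_mx !addr0 !add0r.
by rewrite -scalar_mx_block mul1mx.
Qed.

Lemma differentiable_jacobianE d c (f : 'rV[R]_d -> 'rV[R]_c) u v :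
  differentiable f u -> 'd f u v = v *m 'J f u.
Proof. by move=> df; rewrite /jacobian mul_rV_lin1. Qed.

Lemma jacobian_approx d c (f : 'rV[R]_d -> 'rV[R]_c) (u0 : 'rV[R]_d) :
  differentiable f u0 -> forall eta : R, 0 < eta ->
  \forall u \near u0, `|f u - f u0 - (u - u0) *m 'J f u0| <= eta * `|u - u0|.
Proof.
move=> df eta eta0.
have /eqaddoP/(_ _ eta0)/nbhs_ballP[e /= e0 H] := diff_locally df.
apply/nbhs_ballP; exists e => //= u.
rewrite -ball_normE /= => uu0.
have := H (u - u0); rewrite -ball_normE /= sub0r normrN distrC => /(_ uu0).
rewrite !fctE /= subrK opprD addrA differentiable_jacobianE//.
Qed.


(* A chart-free way to say that [xi] is orthogonal to the tangent space. *)
Definition conormal n (M : set 'rV[R]_n) (x xi : 'rV[R]_n) : Prop :=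
  forall eta : R, 0 < eta ->
    \forall y \near x, M y -> `|dot xi (y - x)| <= eta * `|y - x|.

Lemma dot_mulmx m p (x : 'rV[R]_p) (v : 'rV[R]_m) (X : 'M[R]_(m, p)) :
  dot x (v *m X) = dot (x *m X^T) v.
Proof. by rewrite /dot trmx_mul mulmxA. Qed.

Lemma dot_small_eq0 d (u0 v : 'rV[R]_d) :
  (forall eta : R, 0 < eta ->
    \forall u \near u0, `|dot v (u - u0)| <= eta * `|u - u0|) -> v = 0.
Proof.
move=> H; apply/eqP; rewrite -dot_eq0; apply/eqP/le_anti; rewrite dot_ge0 andbT.
apply/ler_addgt0Pr => eta eta0; rewrite add0r.
have e0 : 0 < eta / (`|v| + 1) by rewrite divr_gt0// ltr_wpDl.
have /nbhs_ballP[e /= e1 He] := H _ e0.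
(* The test point is [u0 + t *: v], at which the linear form takes the value [t * dot v v]; the
   [+ 1] covers [v = 0]. *)
pose t := e / 2 / (`|v| + 1).
have t0 : 0 < t by rewrite !divr_gt0// ltr_wpDl.
have tv : `|t *: v| < e.
  rewrite normrZ gtr0_norm// /t mulrAC ltr_pdivrMr ?ltr_wpDl//.
  by apply: ltr_pM; rewrite ?divr_ge0 ?(ltW e1)//; [lra|rewrite ltrDl].
have := He (u0 + t *: v); rewrite -ball_normE /= opprD addNKr normrN => /(_ tv).
have -> : u0 + t *: v - u0 = t *: v by rewrite addrAC subrr add0r.
rewrite normrZ dotZr normrM (gtr0_norm t0) mulrCA ler_pM2l//.
rewrite ger0_norm ?dot_ge0// => /le_trans; apply.
rewrite mulrAC ler_pdivrMr ?ltr_wpDl// ler_wpM2l ?(ltW eta0)//.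
by rewrite lerDl.
Qed.

(** * Normals of a graph patch *)

Section patch.
Variables (n d c : nat) (A : 'M[R]_(d, n)) (B : 'M[R]_(c, n)).
Hypothesis frame : graph_frame A B.
Variables (M W : set 'rV[R]_n) (U : set 'rV[R]_d) (f : 'rV[R]_d -> 'rV[R]_c).
Let Phi u := u *m A + f u *m B.
Hypotheses (U_open : open U) (W_open : open W) (MW : M `&` W = Phi @` U).

Lemma graph_projA u : Phi u *m A^T = u.
Proof.
by case: frame => h1 _ h2 _ _; rewrite mulmxDl -!mulmxA h1 h2 mulmx1 mulmx0 addr0.
Qed.

Lemma graph_projB u : Phi u *m B^T = f u.
Proof.
by case: frame => _ h1 _ h2 _; rewrite mulmxDl -!mulmxA h1 h2 mulmx1 mulmx0 add0r.
Qed.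

Lemma graph_patchP y : (M `&` W) y -> U (y *m A^T) /\ Phi (y *m A^T) = y.
Proof. by rewrite MW => -[u Uu <-]; rewrite graph_projA. Qed.

Lemma graph_mem u : U u -> M (Phi u) /\ W (Phi u).
Proof. by move=> Uu; have : (Phi @` U) (Phi u) by [exists u]; rewrite -MW. Qed.

Lemma mulmx_continuous m p q (X : 'M[R]_(p, q)) :
  continuous (fun v : 'M[R]_(m, p) => v *m X).
Proof.
apply: (@lipschitz_continuous _ _ _ (p%:R * `|X|)) => y z.
by rewrite -mulmxBl (le_trans (mulmx_norm_le _ _))// mulrAC.
Qed.

Lemma graph_coord_le u v : `|u - v| <= n%:R * `|A^T| * `|Phi u - Phi v|.
Proof.
have -> : u - v = (Phi u - Phi v) *m A^T by rewrite mulmxBl !graph_projA.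
by rewrite (le_trans (mulmx_norm_le _ _))// mulrAC.
Qed.

Section at_point.
Variable u0 : 'rV[R]_d.
Hypotheses (Uu0 : U u0) (df : differentiable f u0).
Let J := 'J f u0.
Let err u := f u - f u0 - (u - u0) *m J.

Lemma graph_lipschitz : exists2 K : R, 0 < K &
  \forall u \near u0, `|Phi u - Phi u0| <= K * `|u - u0|.
Proof.
exists (d%:R * `|A| + c%:R * (1 + d%:R * `|J|) * `|B| + 1).
  by rewrite ltr_wpDl// addr_ge0 ?mulr_ge0 ?addr_ge0 ?mulr_ge0.
have := jacobian_approx df (@ltr01 R); apply: filterS => u; rewrite mul1r => Hu.
have fu : `|f u - f u0| <= (1 + d%:R * `|J|) * `|u - u0|.
  rewrite -[f u - f u0](subrK ((u - u0) *m J)) (le_trans (ler_normD _ _))//.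
  by rewrite mulrDl mul1r lerD// (le_trans (mulmx_norm_le _ _))// mulrAC.
have -> : Phi u - Phi u0 = (u - u0) *m A + (f u - f u0) *m B.
  by rewrite !mulmxBl /Phi opprD addrACA.
apply: le_trans (ler_normD _ _) _.
rewrite [leRHS]mulrDl mul1r [X in _ <= X + _]mulrDl -[leLHS]addr0 lerD// lerD//.
  by rewrite (le_trans (mulmx_norm_le _ _))// mulrAC.
apply: le_trans (mulmx_norm_le _ _) _.
rewrite [leRHS](_ : _ = c%:R * ((1 + d%:R * `|J|) * `|u - u0|) * `|B|); last by ring.
by rewrite ler_wpM2r// ler_wpM2l.
Qed.

Lemma graph_near (P : set 'rV[R]_n) :
  (\forall y \near Phi u0, P y) -> \forall u \near u0, P (Phi u).
Proof.
have [K K0 HK] := graph_lipschitz.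
move=> /nbhs_ballP[e /= e0 eP].
have He : \forall u \near u0, `|u - u0| < e / K.
  apply/nbhs_ballP; exists (e / K) => /= [|z]; first by rewrite divr_gt0.
  by rewrite -ball_normE /= distrC.
apply: filterS2 HK He => u Ku; rewrite ltr_pdivlMr// mulrC => uK.
by apply: eP; rewrite -ball_normE /= distrC (le_lt_trans Ku).
Qed.

(** Splits the increment into a part linear in [u - u0] and a remainder of smaller order; [xi] is
    normal exactly when the linear part vanishes. *)
Lemma dot_graph xi u : dot xi (Phi u - Phi u0) =
  dot (xi *m A^T + xi *m B^T *m J^T) (u - u0) + dot (xi *m B^T) (err u).
Proof.
have -> : Phi u - Phi u0 = (u - u0) *m A + (err u + (u - u0) *m J) *m B.
  by rewrite /err subrK !mulmxBl /Phi opprD addrACA.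
rewrite dotDr !dot_mulmx dotDr dot_mulmx dotDl; ring.
Qed.

(** The tangent space is spanned by the rows of [A + J B], and
    [(A + J B) (B - J^T A)^T = - J + J = 0] by the frame relations. *)
Lemma conormal_graph (zeta : 'rV[R]_c) :
  W (Phi u0) -> conormal M (Phi u0) (zeta *m (B - J^T *m A)).
Proof.
move=> Wx eta eta0; set xi := zeta *m _.
have [h1 h2 h3 h4 _] := frame.
have xiA : xi *m A^T = - zeta *m J^T.
  by rewrite /xi mulmxBr mulmxBl -!mulmxA h1 h3 mulmx1 mulmx0 sub0r mulNmx.
have xiB : xi *m B^T = zeta.
  by rewrite /xi mulmxBr mulmxBl -!mulmxA h2 h4 mulmx1 !mulmx0 subr0.
pose K := c%:R * `|zeta| * (n%:R * `|A^T|) + 1.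
have K0 : 0 < K by rewrite ltr_wpDl// !mulr_ge0.
have /(jacobian_approx df) Hu : 0 < eta / K by rewrite divr_gt0.
have HA : \forall y \near Phi u0, `|err (y *m A^T)| <= eta / K * `|y *m A^T - u0|.
  have := @mulmx_continuous 1 n d A^T (Phi u0).
  by rewrite /continuous_at graph_projA => /(_ _ Hu).
have HW : \forall y \near Phi u0, W y by apply: open_nbhs_nbhs.
apply: filterS2 HA HW => y Ey Wy My.
have [Uy yE] := graph_patchP (conj My Wy).
rewrite -{1}yE dot_graph xiA xiB mulNmx addNr [dot 0 _]/dot mul0mx mxE add0r.
apply: le_trans (dot_norm_le _ _) _.
have := graph_coord_le (y *m A^T) u0; rewrite yE => Hc.
apply: (@le_trans _ _ (c%:R * `|zeta| * (eta / K * (n%:R * `|A^T| * `|y - Phi u0|)))).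
  rewrite ler_wpM2l ?mulr_ge0// (le_trans Ey)// ler_wpM2l// ltW//.
  by rewrite divr_gt0.
rewrite [leLHS](_ : _ = (c%:R * `|zeta| * (n%:R * `|A^T|)) / K * (eta * `|y - Phi u0|)).
  rewrite ler_piMl ?mulr_ge0 ?(ltW eta0)// ler_pdivrMr// mul1r /K lerDl//.
by ring.
Qed.

(** Testing on the graph kills the linear part in [dot_graph], so the height component [xi *m B^T]
    determines the horizontal one; [frame_id] reassembles the two. *)
Lemma conormal_graph_inv (xi : 'rV[R]_n) :
  conormal M (Phi u0) xi -> xi = (xi *m B^T) *m (B - J^T *m A).
Proof.
move=> Hxi; have [h1 h2 h3 h4 h5] := frame.
suff H : xi *m A^T + xi *m B^T *m J^T = 0.
  rewrite -[LHS]mulmx1 -h5 mulmxDr !mulmxA mulmxBr !mulmxA.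
  by rewrite -[X in _ - X *m A](addKr (xi *m A^T)) H addr0 mulNmx opprK addrC.
apply: (@dot_small_eq0 _ u0) => eta eta0.
have [K K0 HK] := graph_lipschitz.
pose K' := K + c%:R * `|xi *m B^T|.
have K'0 : 0 < K' by rewrite ltr_pwDl// mulr_ge0.
have eK : 0 < eta / K' by rewrite divr_gt0.
have HP := graph_near (Hxi _ eK).
have HU : \forall u \near u0, U u by apply: open_nbhs_nbhs.
have HJ := jacobian_approx df eK.
near=> u.
have Uu : U u by near: u.
have Ku : `|Phi u - Phi u0| <= K * `|u - u0| by near: u.
have Ju : `|err u| <= eta / K' * `|u - u0| by near: u.
have Pu : M (Phi u) -> `|dot xi (Phi u - Phi u0)| <= eta / K' * `|Phi u - Phi u0| by near: u.
rewrite -[dot _ _](addrK (dot (xi *m B^T) (err u))) -dot_graph.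
apply: le_trans (ler_normB _ _) _.
apply: (@le_trans _ _ (eta / K' * (K * `|u - u0|) +
   c%:R * `|xi *m B^T| * (eta / K' * `|u - u0|))).
  apply: lerD; last first.
    by apply: le_trans (dot_norm_le _ _) _; rewrite ler_wpM2l ?mulr_ge0.
  apply: le_trans (Pu (graph_mem Uu).1) _.
  by rewrite ler_wpM2l// ltW.
rewrite le_eqVlt; apply/orP; left; apply/eqP; rewrite /K'; field.
by rewrite gt_eqF.
Unshelve. all: by end_near. Qed.

End at_point.
End patch.
End graph.

(** * Area of small balls *)

(* Unlike [ge0_le_integral], this needs no measurability: the integral of a
   nonnegative function is a supremum over simple functions below it. *)
Lemma ge0_subset_le_integral d (T : measurableType d) (R : realType)
    (mu : {measure set T -> \bar R}) (D D' : set T) (f g : T -> \bar R) :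
  D `<=` D' -> (forall x, D x -> (0 <= f x)%E) -> (forall x, D' x -> (0 <= g x)%E) ->
  (forall x, D x -> (f x <= g x)%E) ->
  (\int[mu]_(x in D) f x <= \int[mu]_(x in D') g x)%E.
Proof.
move=> DD' f0 g0 fg; rewrite !ge0_integralE//.
apply: le_ereal_sup => _ [h hf <-]; exists h => // x; apply: le_trans (hf x) _.
rewrite /patch; case: ifPn => [/set_mem Dx|xD].
  by rewrite mem_set; [exact: fg|exact: DD'].
by case: ifPn => // /set_mem; exact: g0.
Qed.

Section lebesgue_ball.
Context {R : realType}.

(** For the max norm a ball is a cube, and the recursion of [lebesgue_rV] splits off one side at a
    time. *)
Lemma lebesgue_rV_ball d (u : 'rV[R]_d) (t : R) : 0 < t ->
  lebesgue_rV (ball u t : set (borel R d)) = ((2 * t) ^+ d)%:E.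
Proof.
move=> t0; elim: d u => [|d IH] u.
  by rewrite expr0 /= diracE mem_set// (_ : u = 0); [exact: ballxx|apply/rowP => -[]].
pose v : 'rV[R]_d := \row_j u 0 (lift 0 j).
rewrite /= (_ : _ @^-1` _ = ball (u 0 0) t `*` ball v t); last first.
  apply/seteqP; split => [[p w] /= /(rV_ballP _ _ t0) H|[p w] [/= Hp /(rV_ballP _ _ t0) Hw]].
    have consE j := H j; split => /=.
      have := H 0; rewrite /cons_rV /= mxE; case: splitP => // k _.
      by rewrite !mxE !ord1 eqxx mulr1n.
    apply/rV_ballP => // j; have := H (lift 0 j); rewrite /cons_rV /= mxE [v 0 j]mxE.
    case: splitP => [k /= kj|k /= [kj]]; first by have := ltn_ord k; rewrite -kj.
    by rewrite (_ : j = k) //; apply: val_inj.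
  apply/rV_ballP => // j; rewrite /cons_rV /= mxE; case: splitP => [k jk|k jk].
    rewrite !mxE !ord1 eqxx mulr1n (_ : j = 0)//; apply: val_inj.
    by rewrite /= jk ord1.
  have := Hw k; rewrite mxE (_ : lift 0 k = j)//.
  by apply: val_inj; rewrite /= jk.
rewrite product_measure1E/=.
- by rewrite IH lebesgue_measure_ball ?ltW// -EFinM exprS -[t *+ 2]mulr_natl.
- exact: measurable_realfun.measurable_ball.
- by apply: open_measurable_borel; exact: ball_open.
Qed.
End lebesgue_ball.

(** * Gram determinants *)

Section gram.
Context {R : realType}.

Lemma det_1gram_neq0 d c (X : 'M[R]_(d, c)) (t : R) : 0 <= t ->
  \det (1%:M + t *: (X *m X^T)) != 0.
Proof.
move=> t0; apply/negP => /det0P[v v0].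
rewrite mulmxDr mulmx1 -scalemxAr => H.
have : dot v v + t * dot (v *m X) (v *m X) = 0.
  have -> : dot (v *m X) (v *m X) = dot v (v *m (X *m X^T)).
    by rewrite (dotC v) /dot trmx_mul !mulmxA.
  by rewrite -dotZr -dotDr H /dot trmx0 mulmx0 mxE.
have := dot_gt0 v; rewrite v0 => vv.
have : 0 <= t * dot (v *m X) (v *m X) by rewrite mulr_ge0// dot_ge0.
lra.
Qed.

(** Positivity without eigenvalues: [\det (1 + t X X^T)] is a polynomial in [t], equal to [1] at [0]
    and without zero on [[0, 1]]. The intermediate value theorem is applied to [- q], whose signs
    come in the required order. *)
Lemma det_1gram_gt0 d c (X : 'M[R]_(d, c)) : 0 < \det (1%:M + X *m X^T).
Proof.
rewrite ltNge; apply/negP => le0.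
pose q : {poly R} := \det (1%:M + 'X *: map_mx polyC (X *m X^T)).
have qE t : q.[t] = \det (1%:M + t *: (X *m X^T)).
  rewrite /q -horner_evalE -det_map_mx; congr (\det _).
  by apply/matrixP => i j; rewrite !mxE /= /horner_eval !hornerE; case: eqP; rewrite ?hornerE.
have [t t01 /eqP] : exists2 t, t \in `[0, 1] & root (- q) t.
  apply: poly_ivt => //; rewrite !hornerN !qE scale0r scale1r addr0 det1.
  by rewrite oppr_le0 ler01 oppr_ge0.
rewrite hornerN => /eqP; rewrite oppr_eq0 qE; apply/negP/det_1gram_neq0.
by move: t01; rewrite in_itv => /andP[].
Qed.

Lemma continuous_sum_fun (T : topologicalType) (I : Type) (r : seq I) (F : I -> T -> R) :
  (forall i, continuous (F i)) -> continuous (fun x => \sum_(i <- r) F i x).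
Proof. by move=> cF; apply: continuous_big => //; exact: add_continuous. Qed.

Lemma continuous_prod_fun (T : topologicalType) (I : Type) (r : seq I) (F : I -> T -> R) :
  (forall i, continuous (F i)) -> continuous (fun x => \prod_(i <- r) F i x).
Proof. by move=> cF; apply: continuous_big => //; exact: mul_continuous. Qed.

Lemma continuous_det_1gram d c :
  continuous (fun X : 'M[R]_(d, c) => \det (1%:M + X *m X^T)).
Proof.
rewrite /determinant; apply: continuous_sum_fun => s.
apply: continuousMf; first exact: cst_continuous.
apply: continuous_prod_fun => i.
under eq_fun do rewrite !mxE.
apply: continuousDf; first exact: cst_continuous.
apply: continuous_sum_fun => k.
under eq_fun do rewrite !mxE.
by apply: continuousMf; exact: coord_continuous.
Qed.

(** The Jacobian of the graph map is [A + J B]; the frame relations cancel the cross terms of its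
    Gram matrix. *)
Lemma gram_density_graph n d c (A : 'M[R]_(d, n)) (B : 'M[R]_(c, n))
    (f : 'rV[R]_d -> 'rV[R]_c) u :
  graph_frame A B -> differentiable f u ->
  gram_density (fun u => u *m A + f u *m B) u =
  Num.sqrt (\det (1%:M + 'J f u *m ('J f u)^T)).
Proof.
move=> [h1 h2 h3 h4 _] df; rewrite /gram_density.
suff -> : 'J (fun u : 'rV[R]_d => u *m A + f u *m B) u = A + 'J f u *m B.
  congr (Num.sqrt (\det _)); rewrite linearD /= trmx_mul mulmxDr !mulmxDl.
  rewrite h1 !mulmxA h2 mul0mx add0r -(mulmxA _ B) h3 mulmx0 addr0.
  by rewrite -(mulmxA _ B) h4 mulmx1.
have cA : continuous (mulmxr A : 'rV[R]_d -> 'rV[R]_n) by exact: mulmx_continuous.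
have cB : continuous (mulmxr B : 'rV[R]_c -> 'rV[R]_n) by exact: mulmx_continuous.
have dA : differentiable (mulmxr A : 'rV[R]_d -> 'rV[R]_n) u.
  exact: linear_differentiable.
have dB : differentiable (mulmxr B : 'rV[R]_c -> 'rV[R]_n) (f u).
  exact: linear_differentiable.
apply/row_matrixP => i; rewrite !rowE.
have -> : (fun u : 'rV[R]_d => u *m A + f u *m B) =
    (mulmxr A : 'rV[R]_d -> 'rV[R]_n) + (mulmxr B \o f) by [].
rewrite -differentiable_jacobianE; last first.
  by apply: differentiableD => //; exact: differentiable_comp.
have dfB : differentiable (mulmxr B \o f) u by exact: differentiable_comp.
have dAE : 'd (mulmxr A : 'rV[R]_d -> 'rV[R]_n) u = mulmxr A :> (_ -> _).
  exact: diff_lin.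
have dBE : 'd (mulmxr B : 'rV[R]_c -> 'rV[R]_n) (f u) = mulmxr B :> (_ -> _).
  exact: diff_lin.
have dBf : 'd (mulmxr B \o f) u = mulmxr B \o 'd f u :> (_ -> _).
  by rewrite (diff_comp df dB); congr (_ \o _).
set v := delta_mx 0 i.
have Ev := congr1 (fun g => g v) (diffD dA dfB).
have Av := congr1 (fun g => g v) dAE.
have Bv := congr1 (fun g => g v) dBf.
apply: (etrans Ev); apply: (etrans (congr2 +%R Av Bv)).
transitivity (v *m A + 'd f u v *m B); first by [].
by rewrite differentiable_jacobianE// mulmxDr mulmxA.
Qed.

End gram.

Lemma near_ball {R : realType} n (x : 'rV[R]_n) (P : set 'rV[R]_n) :
  (\forall y \near x, P y) -> exists2 r : R, 0 < r & forall y, ball x r y -> P y.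
Proof. by move=> /nbhs_ballP[r /= r0 rP]; exists r. Qed.

Lemma half_le_le2 {R : realType} (a b : R) : `|a - b| < b / 2 -> b / 2 <= a <= 2 * b.
Proof. by rewrite ltr_norml => /andP[? ?]; apply/andP; split; lra. Qed.

(** * Two-sided mass bounds in a patch *)

Section patch_measure.
Context {R : realType} {n d c : nat} (A : 'M[R]_(d, n)) (B : 'M[R]_(c, n)).
Hypothesis frame : graph_frame A B.
Variables (eps : R) (M W : set 'rV[R]_n) (U : set 'rV[R]_d) (f : 'rV[R]_d -> 'rV[R]_c).
Let Phi u := u *m A + f u *m B.
Hypotheses (eps_gt0 : 0 < eps) (f_C1 : C1holder eps U f).
Hypotheses (U_open : open U) (W_open : open W) (MW : M `&` W = Phi @` U).

Lemma jacobian_continuous u0 : U u0 -> forall e : R, 0 < e ->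
  \forall u \near u0, U u /\ `|'J f u - 'J f u0| < e.
Proof.
case: f_C1 => _ [K HK] Uu0 e e0.
have HU : \forall u \near u0, U u by apply: open_nbhs_nbhs.
pose a := e / (`|K| + 1).
have a0 : 0 < a by rewrite divr_gt0// ltr_wpDl.
have Hd : \forall u \near u0, `|u - u0| < a `^ eps^-1.
  apply/nbhs_ballP; exists (a `^ eps^-1) => /= [|z]; first exact: powR_gt0.
  by rewrite -ball_normE /= distrC.
apply: filterS2 HU Hd => u Uu ud; split => //.
apply: le_lt_trans (HK _ _ Uu Uu0) _.
have h : `|u - u0| `^ eps < a.
  rewrite -[ltRHS]powRr1 ?ltW// -(mulVf (lt0r_neq0 eps_gt0)) powRrM.
  by rewrite gt0_ltr_powR// nnegrE ?powR_ge0.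
apply: (@le_lt_trans _ _ ((`|K| + 1) * `|u - u0| `^ eps)).
  by rewrite ler_wpM2r ?powR_ge0// (le_trans (ler_norm K))// lerDl.
by rewrite mulrC -ltr_pdivlMr// ltr_wpDl.
Qed.

Lemma gram_density_near u0 : U u0 -> exists2 g0 : R, 0 < g0 &
  \forall u \near u0, g0 / 2 <= gram_density Phi u <= 2 * g0.
Proof.
move=> Uu0; case: (f_C1) => f_diff _.
pose h (X : 'M[R]_(d, c)) := Num.sqrt (\det (1%:M + X *m X^T)).
have ch : continuous h.
  move=> X; apply: (@continuous_comp _ _ _ (fun X : 'M[R]_(d, c) => \det (1%:M + X *m X^T)) Num.sqrt).
    exact: continuous_det_1gram.
  exact: sqrt_continuous.
have h0 : 0 < h ('J f u0) by rewrite sqrtr_gt0 det_1gram_gt0.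
exists (h ('J f u0)) => //.
have : \forall X \near 'J f u0, `|h ('J f u0) - h X| < h ('J f u0) / 2.
  have /cvgrPdist_lt/(_ (h ('J f u0) / 2)) := ch ('J f u0).
  by rewrite divr_gt0// => /(_ isT).
move=> /nbhs_ballP[e /= e0 He].
apply: filterS (jacobian_continuous Uu0 e0) => u [Uu ue].
rewrite (gram_density_graph frame (f_diff _ Uu)) -/(h ('J f u)).
by apply: half_le_le2; rewrite distrC; apply: He; rewrite -ball_normE /= distrC.
Qed.

(** Inside a patch [M] is the zero set of height minus [f], which is continuous at the points of the
    ball because their chart coordinates lie in [U]; so [M] is the ball minus an open set. *)
Lemma measurable_patch_ball x r : ball x r `<=` W ->
  (forall y, ball x r y -> U (y *m A^T)) ->
  measurable (ball x r `&` M : set (borel R n)).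
Proof.
move=> rW rU; case: (f_C1) => f_diff _.
pose h (y : 'rV[R]_n) := y *m B^T - f (y *m A^T).
pose V := ball x r `&` [set y | h y != 0].
have -> : ball x r `&` M = ball x r `\` V.
  apply/seteqP; split => y [ry].
    move=> My; split => // -[_] /=; have [Uy yE] := graph_patchP frame MW (conj My (rW _ ry)).
    by rewrite /h -{1}yE (graph_projB frame) subrr eqxx.
  move=> Vy; split => //; have h0 : h y = 0.
    by apply/eqP; apply: contrapT => /negP hy; apply: Vy; split.
  have [h1 h2 h3 h4 h5] := frame.
  have : M (Phi (y *m A^T)) by exact: (graph_mem MW (rU _ ry)).1.
  rewrite /Phi (_ : f (y *m A^T) = y *m B^T).
    by rewrite -!mulmxA -mulmxDr h5 mulmx1.
  by apply/eqP; rewrite eq_sym -subr_eq0; apply/eqP.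
apply: measurableD; first exact: measurable_ball_rV.
apply: open_measurable_borel; rewrite openE => y [ry hy].
have ch : {for y, continuous h}.
  have c1 : {for y, continuous (fun y : 'rV[R]_n => f (y *m A^T))}.
    apply: (@continuous_comp _ _ _ (fun y : 'rV[R]_n => y *m A^T) f).
      exact: mulmx_continuous.
    apply: differentiable_continuous; exact/f_diff/rU.
  exact: (cvgB (@mulmx_continuous R 1 n c B^T y) c1).
have : \forall z \near y, h z != 0.
  exact: (cvgr_neq0 _ ch hy).
have : \forall z \near y, ball x r z by apply: open_nbhs_nbhs; split => //; exact: ball_open.
exact: filterS2.
Qed.

Variable sigma : {measure set (borel R n) -> \bar R}.
Hypothesis sigma_graph : forall S : set (borel R n), measurable S -> S `<=` W ->
  sigma S = (\int[@lebesgue_rV R d]_(u in U `&` Phi @^-1` S) (gram_density Phi u)%:E)%E.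

Variables (O : set 'rV[R]_n) (rho : 'rV[R]_n -> R).
Variable mu : {measure set (borel R n) -> \bar R}.
Hypotheses (O_open : open O) (rho_continuous : {within M `&` O, continuous rho}).
Hypothesis rho_gt0 : forall x, (M `&` O) x -> 0 < rho x.
Hypothesis mu_density : forall S : set (borel R n), measurable S -> S `<=` O ->
  mu S = (\int[sigma]_(x in S `&` M) (rho x)%:E)%E.

(** The graph map is [K]-Lipschitz at [u0], so the chart image of [ball x t] contains a cube of
    radius [t / K]; the projection [A^T] is [K1]-Lipschitz, so it is contained in one of radius
    [K1 t]. Density and area factor vary by at most a factor [2] around their values at [x]. *)
Lemma patch_mass_bounds x : M x -> W x -> O x ->
  exists c1 c2 t0 : R, [/\ 0 < c1, 0 < t0,
    forall t, 0 < t -> t < t0 -> ((c1 * t ^+ d)%:E <= mu (ball x t))%E &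
    forall t, 0 < t -> t < t0 -> (mu (ball x t) <= (c2 * t ^+ d)%:E)%E].
Proof.
move=> Mx Wx Ox; have [Uu0 xE] := graph_patchP frame MW (conj Mx Wx).
set u0 := x *m A^T in Uu0 xE.
have df : differentiable f u0 by case: (f_C1) => /(_ _ Uu0).
have [g0 g00 Hg] := gram_density_near Uu0.
have [K K0 HK] := @graph_lipschitz _ _ _ _ A B f u0 df.
have HU : \forall u \near u0, U u by apply: open_nbhs_nbhs.
have [r1 r10 Hr1] : exists2 r1 : R, 0 < r1 & forall u, ball u0 r1 u ->
    [/\ U u, g0 / 2 <= gram_density Phi u <= 2 * g0 & `|Phi u - Phi u0| <= K * `|u - u0|].
  apply: near_ball; apply: filterS3 HU Hg HK => u *; by split.
have HA : \forall y \near x, ball u0 r1 (y *m A^T).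
  by apply: (@mulmx_continuous _ 1 n d A^T x); exact: nbhsx_ballx.
have HW : \forall y \near x, W y by apply: open_nbhs_nbhs.
have HO : \forall y \near x, O y by apply: open_nbhs_nbhs.
have rx0 : 0 < rho x by exact: rho_gt0.
have Hrho : \forall y \near x, (M `&` O) y -> rho x / 2 <= rho y <= 2 * rho x.
  have /subspace_continuousP/(_ x (conj Mx Ox))/cvgrPdist_lt/(_ (rho x / 2)) := rho_continuous.
  rewrite divr_gt0// => /(_ isT); rewrite near_withinE; apply: filterS => y H /H.
  by rewrite distrC; exact: half_le_le2.
have [r2 r20 Hr2] : exists2 r2 : R, 0 < r2 & forall y, ball x r2 y ->
    [/\ ball u0 r1 (y *m A^T), W y, O y & (M `&` O) y -> rho x / 2 <= rho y <= 2 * rho x].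
  by apply: near_ball; near=> y; split; near: y.
pose K1 := n%:R * `|A^T| + 1.
have K10 : 0 < K1 by rewrite ltr_wpDl// mulr_ge0.
exists (rho x / 2 * (g0 / 2) * (2 / K) ^+ d), (2 * rho x * (2 * g0) * (2 * K1) ^+ d),
  (Num.min r2 (K * r1)).
split.
- by rewrite !mulr_gt0 ?exprn_gt0 ?divr_gt0.
- by rewrite lt_min r20 mulr_gt0.
- move=> t t0; rewrite lt_min => /andP[tr2 tKr1].
  have sub y : ball x t y -> ball x r2 y by apply: le_ball; exact: ltW.
  have mS : measurable (ball x t `&` M : set (borel R n)).
    apply: measurable_patch_ball => y /sub/Hr2[h1 h2 h3 h4] //.
    by have [] := Hr1 _ h1.
  rewrite mu_density; [|exact: measurable_ball_rV|by move=> y /sub/Hr2[]].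
  apply: (@le_trans _ _ (\int[sigma]_(y in ball x t `&` M) (rho x / 2)%:E)%E); last first.
    apply: ge0_subset_le_integral => // y [ty My].
    + by rewrite lee_fin divr_ge0// ltW.
    + by have [_ _ Oy _] := Hr2 _ (sub _ ty); rewrite lee_fin ltW// rho_gt0.
    + by have [_ _ Oy /(_ (conj My Oy))/andP[]] := Hr2 _ (sub _ ty); rewrite lee_fin.
  rewrite integral_cst// sigma_graph//; last by move=> y [/sub/Hr2[]].
  have tK0 : 0 < t / K by rewrite divr_gt0.
  apply: (@le_trans _ _ ((rho x / 2)%:E * \int[@lebesgue_rV R d]_(u in ball u0 (t / K)) (g0 / 2)%:E)%E).
    rewrite integral_cst; last exact: measurable_ball_rV.
    rewrite [X in (_ * (_ * X))%E]lebesgue_rV_ball// -!EFinM lee_fin le_eqVlt; apply/orP; left.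
    by rewrite -!mulrA -exprMn; apply/eqP; do ![congr (_ * _)]; congr (_ ^+ d); ring.
  rewrite lee_pmul2l ?lte_fin ?divr_gt0//.
  apply: ge0_subset_le_integral.
  + move=> u uK; have [Uu _ Ku] : [/\ U u, g0 / 2 <= gram_density Phi u <= 2 * g0 & `|Phi u - Phi u0| <= K * `|u - u0|].
      by apply: Hr1; apply: le_ball uK; rewrite ler_pdivrMr// mulrC ltW.
    split => //; split; last by have [] := graph_mem MW Uu.
    rewrite -xE -ball_normE /= distrC (le_lt_trans Ku)// mulrC -ltr_pdivlMr//.
    by move: uK; rewrite -ball_normE /= distrC.
  + by move=> *; rewrite lee_fin divr_ge0// ltW.
  + by move=> *; rewrite lee_fin sqrtr_ge0.
  + move=> u uK; rewrite lee_fin.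
    have [|_ /andP[]//] := Hr1 u; apply: le_ball uK.
    by rewrite ler_pdivrMr// mulrC ltW.
- move=> t t0; rewrite lt_min => /andP[tr2 tKr1].
  have sub y : ball x t y -> ball x r2 y by apply: le_ball; exact: ltW.
  have mb : measurable (ball x t : set (borel R n)) by exact: measurable_ball_rV.
  rewrite mu_density//; last by move=> y /sub/Hr2[].
  apply: (@le_trans _ _ (\int[sigma]_(y in ball x t) (2 * rho x)%:E)%E).
    apply: ge0_subset_le_integral => [y []//|y [ty My]|y _|y [ty My]].
    + by have [_ _ Oy _] := Hr2 _ (sub _ ty); rewrite lee_fin ltW// rho_gt0.
    + by rewrite lee_fin mulr_ge0// ltW.
    + by have [_ _ Oy /(_ (conj My Oy))/andP[]] := Hr2 _ (sub _ ty); rewrite lee_fin.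
  rewrite integral_cst// sigma_graph//; last by move=> y /sub/Hr2[].
  have tK1 : 0 < K1 * t by rewrite mulr_gt0.
  apply: (@le_trans _ _ ((2 * rho x)%:E * \int[@lebesgue_rV R d]_(u in ball u0 (K1 * t)) (2 * g0)%:E)%E); last first.
    rewrite integral_cst; last exact: measurable_ball_rV.
    rewrite [X in (_ * (_ * X))%E]lebesgue_rV_ball// -!EFinM lee_fin le_eqVlt; apply/orP; left.
    by rewrite mulrA exprMn exprMn exprMn !mulrA.
  rewrite lee_pmul2l ?lte_fin ?mulr_gt0//.
  have uB u : (U `&` Phi @^-1` ball x t) u -> ball u0 r1 u /\ ball u0 (K1 * t) u.
    move=> [Uu ut]; split.
      by have [] := Hr2 _ (sub _ ut); rewrite (graph_projA frame).
    rewrite -ball_normE /= distrC; apply: le_lt_trans (graph_coord_le frame f u u0) _.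
    move: ut; rewrite /= -ball_normE /= distrC -{1}xE => ut.
    apply: (@le_lt_trans _ _ (K1 * `|Phi u - Phi u0|)); last by rewrite ltr_pM2l.
    by rewrite ler_wpM2r// lerDl.
  apply: ge0_subset_le_integral.
  + by move=> u /uB[].
  + by move=> *; rewrite lee_fin sqrtr_ge0.
  + by move=> *; rewrite lee_fin mulr_ge0// ltW.
  + by move=> u /uB[/Hr1[_ /andP[_ h] _] _]; rewrite lee_fin.
Unshelve. all: by end_near. Qed.

End patch_measure.

(** * Normal directions of a lighthouse manifold *)

Section conormal_theory.
Context {R : realType} {n : nat}.
Implicit Types (M : set 'rV[R]_n) (x xi v : 'rV[R]_n).

Lemma conormalZ M x xi (a : R) : conormal M x xi -> conormal M x (a *: xi).
Proof.
move=> Hxi eta eta0; have a0 : 0 < `|a| + 1 by rewrite ltr_wpDl.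
have /Hxi : 0 < eta / (`|a| + 1) by rewrite divr_gt0.
apply: filterS => y H /H{}H; rewrite dotZl normrM.
apply: (@le_trans _ _ ((`|a| + 1) * (eta / (`|a| + 1) * `|y - x|))).
  by apply: ler_pM => //; rewrite lerDl.
by rewrite mulrCA mulrA mulfVK ?gt_eqF.
Qed.

(** The difference quotients [q h] of the curve satisfy [|dot xi (q h)| <= eta * |q h|] and tend to
    [v]; a single small nonzero [h] is enough for each error [e]. *)
Lemma conormal_tangent M M' x xi v : M' `<=` M ->
  conormal M x xi -> tangent M' x v -> dot xi v = 0.
Proof.
move=> M'M Hxi [gamma [g0 gM [gd gv]]].
apply/eqP; rewrite -normr_le0; apply/ler_addgt0Pr => e e0; rewrite add0r.
pose K := `|v| + 1 + n%:R * `|xi|.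
have K0 : 0 < K by rewrite ltr_wpDr ?mulr_ge0// ltr_wpDl.
(* The [1] keeps [|q h|] below [|v| + 1]; [e / K] pays for both that term and the error
   [v - q h]. *)
pose eta := Num.min 1 (e / K).
have eta0 : 0 < eta by rewrite lt_min ltr01 divr_gt0.
pose q (h : R) := h^-1 *: (gamma (h *: (1 : R) + 0) - gamma 0).
have qv : q h @[h --> 0^'] --> v by rewrite -gv; exact: gd.
have gc : gamma h @[h --> (0 : R)] --> x.
  rewrite -g0; apply: differentiable_continuous; exact/derivable1_diffP.
have Hg : \forall h \near (0 : R), `|dot xi (gamma h - x)| <= eta * `|gamma h - x|.
  by apply: filterS2 gM (gc _ (Hxi _ eta0)) => h /M'M Mh; exact.
have Hg' : \forall h \near (0 : R)^', `|dot xi (gamma h - x)| <= eta * `|gamma h - x|.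
  exact: cvg_within.
have Hq : \forall h \near (0 : R)^', `|v - q h| < eta.
  by move/cvgrPdist_lt : qv; exact.
have : \forall h \near (0 : R)^', `|dot xi (gamma h - x)| <= eta * `|gamma h - x| /\
    `|v - q h| < eta by exact: filterI.
move=> /(@filter_ex _ _ (Proper_dnbhs_numFieldType _))[h [h1 h2]].
have eta1 : eta <= 1 by rewrite ge_min lexx.
have qE : q h = h^-1 *: (gamma h - x).
  by rewrite /q g0; congr (_ *: (gamma _ - _)); rewrite addr0 /GRing.scale/= mulr1.
have q1 : `|dot xi (q h)| <= eta * `|q h|.
  by rewrite qE dotZr normrM normrZ mulrCA ler_wpM2l.
have q2 : `|q h| <= `|v| + 1.
  rewrite -[q h](subrK v) addrC (le_trans (ler_normD _ _))// lerD2l distrC.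
  exact: le_trans (ltW h2) eta1.
have q3 : `|dot xi (v - q h)| <= eta * (n%:R * `|xi|).
  by rewrite mulrC (le_trans (dot_norm_le _ _))// ler_wpM2l ?mulr_ge0// ltW.
rewrite -[v](subrK (q h)) dotDr (le_trans (ler_normD _ _))//.
apply: (@le_trans _ _ (eta * K)); last by rewrite -ler_pdivlMr// ge_min lexx orbT.
rewrite /K [leRHS]mulrDr addrC lerD//.
by rewrite (le_trans q1)// ler_wpM2l// ltW.
Qed.

End conormal_theory.

(** One linear equation in at least two unknowns. It will produce a normal vector in the hyperplane
    orthogonal to [l], where neither [C] nor [- C] has a nonzero point. *)
Lemma small_conormal_space {R : realType} n c (N : 'M[R]_(c, n)) (l : 'rV[R]_n) :
  (1 < c)%N -> exists2 zeta : 'rV[R]_c, zeta != 0 & dot l (zeta *m N) = 0.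
Proof.
move=> c1; pose w := N *m l^T.
have : kermx w != 0.
  rewrite kermx_eq0 /row_free; apply/eqP => rw.
  by have := rank_leq_col w; rewrite rw leqNgt c1.
move=> /rowV0Pn[zeta /sub_kermxP zw z0]; exists zeta => //.
by rewrite dotC /dot -mulmxA zw mxE.
Qed.

Lemma dot_self_continuous {R : realType} n : continuous (fun w : 'rV[R]_n => dot w w).
Proof.
under eq_fun do rewrite dotE.
apply: continuous_sum_fun => j.
by apply: continuousMf; exact: coord_continuous.
Qed.

(* The sign of [a] is recovered from [l], its absolute value from the norm;
   the right-hand side is continuous in [w]. *)
Lemma unit_multiple {R : realType} n (l v w : 'rV[R]_n) (a : R) :
  v = a *: w -> dot v v = 1 -> 0 < dot l v ->
  v = (dot l w / (`|dot l w| * Num.sqrt (dot w w))) *: w.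
Proof.
move=> -> ; rewrite !dotZl !dotZr => vv lv; congr (_ *: _).
have s1 : `|a| * Num.sqrt (dot w w) = 1.
  by rewrite -sqrtr_sqr -sqrtrM ?sqr_ge0// expr2 -mulrA vv sqrtr1.
have s0 : Num.sqrt (dot w w) != 0.
  by apply/eqP => s0; move: s1; rewrite s0 mulr0 => /esym/eqP; rewrite oner_eq0.
have l0 : dot l w != 0 by apply/eqP => l0; move: lv; rewrite l0 mulr0 ltxx.
have la : a * dot l w = `|a| * `|dot l w| by rewrite -normrM gtr0_norm.
apply: (mulIf (_ : `|dot l w| * Num.sqrt (dot w w) != 0)).
  by rewrite mulf_neq0 ?normr_eq0.
rewrite divfK ?mulf_neq0 ?normr_eq0//.
have a0 : a != 0 by apply/eqP => a0; move: lv; rewrite a0 mul0r ltxx.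
apply: (mulfI a0); rewrite la.
rewrite (_ : a * _ = (a * a) * Num.sqrt (dot w w) * `|dot l w|); last by ring.
have -> : a * a = `|a| * `|a| by rewrite -normrM ger0_norm// -expr2 sqr_ge0.
by rewrite -(mulrA `|a|) s1 mulr1.
Qed.

Section lighthouse_manifold.
Context (R : realType) (n d : nat)
    (mu : {measure set (borel R n) -> \bar R}) (C : set 'rV[R]_n)
    (eps : R) (M B : set 'rV[R]_n)
    (sigma : {measure set (borel R n) -> \bar R}) (rho : 'rV[R]_n -> R).
Hypotheses (mu_lighthouse : lighthouse mu C)
    (eps01 : 0 < eps < 1)
    (M_submanifold : C1holder_submanifold d eps M)
    (sigma_volume : is_volume_measure d eps M sigma)
    (B_open : open B)
    (rho_continuous : {within M `&` B, continuous rho})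
    (rho_gt0 : forall x, (M `&` B) x -> 0 < rho x)
    (mu_density : forall A : set (borel R n), measurable A -> A `<=` B ->
      mu A = (\int[sigma]_(x in A `&` M) (rho x)%:E)%E).

Let eps_gt0 : 0 < eps. Proof. by case/andP: eps01. Qed.

Lemma manifold_patch x : M x -> exists c (_ : (d + c)%N = n) (A : 'M[R]_(d, n)) (D : 'M[R]_(c, n))
   (W : set 'rV[R]_n) (U : set 'rV[R]_d) (f : 'rV[R]_d -> 'rV[R]_c),
   [/\ W x, graph_frame A D, C1holder eps U f, open U & open W] /\
   M `&` W = (fun u => u *m A + f u *m D) @` U /\
   forall S : set (borel R n), measurable S -> S `<=` W ->
     sigma S = (\int[@lebesgue_rV R d]_(u in U `&` (fun u => u *m A + f u *m D)%R @^-1` S)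
       (gram_density (fun u => u *m A + f u *m D)%R u)%:E)%E.
Proof.
move=> /M_submanifold[c [E [Q [U [f [W [Wx P]]]]]]].
have [rQ oU fC oW MW] := P.
have [A [D [frame PhiE]]] := graph_map_frame E rQ.
have {}PhiE : graph_map E Q f = fun u => u *m A + f u *m D by exact/funext/PhiE.
have := sigma_volume.2 _ _ _ _ _ _ P; rewrite PhiE => sP.
by exists c, E, A, D, W, U, f; split => //; split => //; rewrite -PhiE.
Qed.

Lemma mass_bounds x : (M `&` B) x -> exists c1 c2 t0 : R, [/\ 0 < c1, 0 < t0,
    forall t, 0 < t -> t < t0 -> ((c1 * t ^+ d)%:E <= mu (ball x t))%E &
    forall t, 0 < t -> t < t0 -> (mu (ball x t) <= (c2 * t ^+ d)%:E)%E].
Proof.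
move=> [Mx Bx].
have [c [_ [A [D [W [U [f [[Wx fr fC oU oW] [MW sP]]]]]]]]] := manifold_patch Mx.
exact: (patch_mass_bounds fr eps_gt0 fC oU oW MW sP B_open rho_continuous rho_gt0 mu_density).
Qed.

(** In a small ball no point of [M] violates the conormal inequality, and in [B] the measure is an
    integral over [M]; so the off-cone set is null, as the blow-up requires. *)
Lemma conormal_cone x xi : (M `&` B) x -> conormal M x xi -> C xi \/ C (- xi).
Proof.
move=> MBx Hxi; have [c1 [c2 [t0 [c10 t00 ge le]]]] := mass_bounds MBx.
have [mu_radon mu_per [C_cone C_closed _ _ _] _ mu_spec] := mu_lighthouse.
apply: (blowup_spectrum mu_radon mu_per C_cone C_closed mu_spec c10 t00 ge le).
move=> eta eta0.
have HB : \forall y \near x, B y by apply: open_nbhs_nbhs; split => //; exact: MBx.2.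
have [t1 t10 Ht] : exists2 t1 : R, 0 < t1 & forall y, ball x t1 y ->
    B y /\ (M y -> `|dot xi (y - x)| <= eta * `|y - x|).
  by apply: near_ball; apply: filterS2 HB (Hxi _ eta0).
exists t1 => //; rewrite mu_density.
- rewrite (_ : _ `&` M = set0) ?integral_set0//.
  apply/seteqP; split => // y [[/Ht[_ Hy] /= off] My].
  by move: off; rewrite ltNge (Hy My).
- exact: measurable_off_cone.
- by move=> y [/Ht[]].
Qed.

(** By the lower mass bound every ball around a point of [M] in [B] has positive mass, so none fits
    into the complement of [S]. *)
Lemma manifold_null_support (S : set 'rV[R]_n) : closed S -> mu (~` S) = 0%E -> M `&` B `<=` S.
Proof.
move=> Scl S0 x MBx; apply: contrapT => Sx.
have oS : open (~` S) by exact: closed_openC.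
have [r r0 rS] : exists2 r : R, 0 < r & forall y, ball x r y -> (~` S) y.
  by apply: near_ball; apply: open_nbhs_nbhs.
have [c1 [c2 [t0 [c10 t00 ge le]]]] := mass_bounds MBx.
pose t := Num.min r (t0 / 2).
have t_gt0 : 0 < t by rewrite lt_min r0 divr_gt0.
have tt0 : t < t0 by rewrite gt_min; apply/orP; right; lra.
have := ge _ t_gt0 tt0; rewrite leNgt => /negP; apply.
apply: (@le_lt_trans _ _ (mu (~` S))).
  apply: le_measure; rewrite ?inE.
  - exact: measurable_ball_rV.
  - exact: open_measurable_borel.
  - by move=> y ty; apply: rS; apply: le_ball ty; rewrite ge_min lexx.
by rewrite S0 lte_fin mulr_gt0// exprn_gt0.
Qed.

Lemma manifold_codim1 x : (M `&` B) x -> n = d.+1.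
Proof.
move=> MBx; have [Mx Bx] := MBx.
have [c [E [A [D [W [U [f [[Wx fr fC oU oW] [MW sP]]]]]]]]] := manifold_patch Mx.
have [_ _ [C_cone C_closed _ _ [l lP]] [S [Scl S0 muS]] _] := mu_lighthouse.
have [Uu0 xE] := graph_patchP fr MW (conj Mx Wx).
have df : differentiable f (x *m A^T) by case: fC => /(_ _ Uu0).
have [c1|c1|c1] := ltngtP c 1; last by rewrite -E c1 addn1.
(* In codimension [0] the frame [A] is invertible, so [M] contains a ball around [x]; that ball lies
   in [S] and has positive Lebesgue measure. *)
- exfalso; case: c c1 E D f fr fC MW sP xE df => // _ E D f fr fC MW sP xE df.
  have D0 : D = 0 by apply/matrixP => -[].
  have AA : A^T *m A = 1%:M.
    by have [_ _ _ _] := fr; rewrite D0 mulmx0 addr0.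
  have HU : \forall y \near x, U (y *m A^T).
    by apply: (@mulmx_continuous _ 1 n d A^T x); apply: open_nbhs_nbhs.
  have HB : \forall y \near x, B y by apply: open_nbhs_nbhs.
  have [r r0 rMB] : exists2 r : R, 0 < r & forall y, ball x r y -> U (y *m A^T) /\ B y.
    by apply: near_ball; apply: filterS2 HU HB.
  have : (lebesgue_rV (ball x r : set (borel R n)) <= lebesgue_rV (S : set (borel R n)))%E.
    apply: le_measure; rewrite ?inE.
    - exact: measurable_ball_rV.
    - rewrite -[X in measurable X]setCK; apply: measurableC.
      by apply: open_measurable_borel; exact: closed_openC.
    - move=> y /rMB[Uy By]; apply: (manifold_null_support Scl muS); split => //.
      have [+ _] := graph_mem MW Uy.
      by rewrite D0 mulmx0 addr0 -mulmxA AA mulmx1.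
  rewrite S0 lebesgue_rV_ball// leNgt lte_fin => /negP; apply.
  by rewrite exprn_gt0// mulr_gt0.
(* In codimension at least [2] some nonzero normal is orthogonal to [l], so neither it nor its
   opposite can lie in the pointed cone. *)
- exfalso; have [zeta z0 zl] := small_conormal_space (D - ('J f (x *m A^T))^T *m A) l c1.
  have := conormal_graph fr oW MW df zeta.
  rewrite xE => /(_ Wx) H.
  set xi := zeta *m _ in zl H.
  have xi0 : xi != 0.
    apply/eqP => xi0; move/eqP: z0; apply.
    have [h1 h2 h3 h4 _] := fr.
    have : xi *m D^T = zeta by rewrite /xi mulmxBr mulmxBl -!mulmxA h2 h4 mulmx1 !mulmx0 subr0.
    by rewrite xi0 mul0mx.
  case: (conormal_cone MBx H) => /lP; rewrite ?oppr_eq0 => /(_ xi0).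
    by rewrite zl ltxx.
  by rewrite dotNr zl oppr0 ltxx.
Qed.

Lemma unit_conormal x : (M `&` B) x ->
  exists v, [/\ C v, dot v v = 1 & conormal M x v].
Proof.
move=> MBx; have [Mx Bx] := MBx; have nd := manifold_codim1 MBx.
have [c [E [A [D [W [U [f [[Wx fr fC oU oW] [MW sP]]]]]]]]] := manifold_patch Mx.
have [_ _ [C_cone _ _ _ _] _ _] := mu_lighthouse.
have [Uu0 xE] := graph_patchP fr MW (conj Mx Wx).
have df : differentiable f (x *m A^T) by case: fC => /(_ _ Uu0).
have c1 : c = 1%N by lia.
subst c; pose zeta : 'rV[R]_1 := const_mx 1.
have := conormal_graph fr oW MW df zeta.
rewrite xE => /(_ Wx); set xi := zeta *m _ => H.
have xi0 : xi != 0.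
  apply/eqP => xi0; have [h1 h2 h3 h4 _] := fr.
  have : xi *m D^T = zeta by rewrite /xi mulmxBr mulmxBl -!mulmxA h2 h4 mulmx1 !mulmx0 subr0.
  by rewrite xi0 mul0mx => /matrixP/(_ 0 0)/eqP; rewrite !mxE eq_sym oner_eq0.
have s0 : 0 < Num.sqrt (dot xi xi) by rewrite sqrtr_gt0 dot_gt0.
pose k := (Num.sqrt (dot xi xi))^-1.
have k0 : 0 < k by rewrite invr_gt0.
have kk : k * (k * dot xi xi) = 1.
  rewrite -[dot xi xi]sqr_sqrtr ?dot_ge0// /k expr2; field; exact: lt0r_neq0.
case: (conormal_cone MBx H) => Cxi.
  exists (k *: xi); split; last exact: conormalZ.
  - exact: (C_cone _ _ k0).1.
  - by rewrite dotZl dotZr.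
exists (k *: - xi); split.
- exact: (C_cone _ _ k0).1.
- by rewrite dotZl dotZr dotNl dotNr opprK.
- by rewrite -scaleN1r scalerA; exact: conormalZ.
Qed.

(** No regularity of the selection is assumed: the three conditions force [nu y] to be [G] of the
    explicit normal [w] in the chart. That normal is continuous with the Jacobian, and the
    denominator of [G] does not vanish at [x]. *)
Lemma unit_conormal_continuous (nu : 'rV[R]_n -> 'rV[R]_n) :
  (forall x, (M `&` B) x -> [/\ C (nu x), dot (nu x) (nu x) = 1 & conormal M x (nu x)]) ->
  {within M `&` B, continuous nu}.
Proof.
move=> nuP; apply/subspace_continuousP => x MBx.
have [Mx Bx] := MBx; have nd := manifold_codim1 MBx.
have [c [E [A [D [W [U [f [[Wx fr fC oU oW] [MW sP]]]]]]]]] := manifold_patch Mx.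
have [_ _ [_ _ _ _ [l lP]] _ _] := mu_lighthouse.
have [Uu0 xE] := graph_patchP fr MW (conj Mx Wx).
have c1 : c = 1%N by lia.
subst c; pose zeta : 'rV[R]_1 := const_mx 1.
pose w u := zeta *m (D - ('J f u)^T *m A).
pose G (v : 'rV[R]_n) := (dot l v / (`|dot l v| * Num.sqrt (dot v v))) *: v.
have nuE y : (M `&` B) y -> W y ->
    nu y = G (w (y *m A^T)) /\ exists a, nu y = a *: w (y *m A^T).
  move=> MBy Wy; have [My By] := MBy; have [Cy ny Hy] := nuP _ MBy.
  have [Uy yE] := graph_patchP fr MW (conj My Wy).
  have dfy : differentiable f (y *m A^T) by case: fC => /(_ _ Uy).
  have := @conormal_graph_inv _ _ _ _ _ _ fr _ _ _ _ oU MW _ Uy dfy (nu y).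
  rewrite yE => /(_ Hy) nuy.
  have nua : nu y = (nu y *m D^T) 0 0 *: w (y *m A^T).
    rewrite {1}nuy /w scalemxAl; congr (_ *m _).
    by move: (nu y *m D^T) => X; apply/matrixP => i j; rewrite !ord1 !mxE mulr1.
  split; last by exists ((nu y *m D^T) 0 0).
  have ny0 : nu y != 0 by rewrite -dot_gt0 ny.
  exact: (unit_multiple nua ny (lP _ Cy ny0)).
have [nux [a nua]] := nuE x MBx Wx.
set u0 := x *m A^T in Uu0 xE nux nua.
have [Cx nx Hx] := nuP _ MBx.
have lnu : 0 < dot l (nu x) by apply: lP => //; rewrite -dot_gt0 nx.
have lw0 : dot l (w u0) != 0.
  by apply/eqP => l0; move: lnu; rewrite nua dotZr l0 mulr0 ltxx.
have w0 : w u0 != 0 by apply/eqP => w0; move: lw0; rewrite w0 /dot trmx0 mulmx0 mxE eqxx.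
have wc : w (y *m A^T) @[y --> x] --> w u0.
  apply: (@cvg_comp _ _ _ (fun y : 'rV[R]_n => y *m A^T) w _ (nbhs u0)).
    exact: mulmx_continuous.
  apply/cvgrPdist_lt => e e0.
  pose K := `|zeta| * (d%:R * `|A|) + 1.
  have K0 : 0 < K by rewrite ltr_wpDl// !mulr_ge0.
  have eK : 0 < e / K by rewrite divr_gt0.
  apply: filterS (jacobian_continuous eps_gt0 fC oU Uu0 eK) => u [_ ue].
  have -> : w u0 - w u = zeta *m (('J f u - 'J f u0)^T *m A).
    rewrite /w -mulmxBr; congr (_ *m _).
    by rewrite [in RHS]linearB mulmxBl opprB addrC addrA subrK.
  apply: le_lt_trans (mulmx_norm_le _ _) _; rewrite mul1r.
  apply: (@le_lt_trans _ _ (`|zeta| * (d%:R * `|'J f u - 'J f u0| * `|A|))).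
    rewrite ler_wpM2l// (le_trans (mulmx_norm_le _ _))// ler_wpM2r// ler_wpM2l//.
    by apply: mx_norm_le => // i j; rewrite mxE norm_coord_le.
  apply: (@le_lt_trans _ _ (K * `|'J f u - 'J f u0|)).
    by rewrite mulrAC mulrA ler_wpM2r// lerDl.
  by rewrite mulrC -ltr_pdivlMr.
have Gc : G (w (y *m A^T)) @[y --> x] --> G (w u0).
  have lc : dot l (w (y *m A^T)) @[y --> x] --> dot l (w u0).
    exact: (cvg_comp _ _ wc (@dot_continuous _ _ l (w u0))).
  have sc : Num.sqrt (dot (w (y *m A^T)) (w (y *m A^T))) @[y --> x] -->
      Num.sqrt (dot (w u0) (w u0)).
    exact: (cvg_comp _ _ (cvg_comp _ _ wc (@dot_self_continuous R n (w u0)))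
      (@sqrt_continuous R (dot (w u0) (w u0)))).
  have nz : `|dot l (w u0)| * Num.sqrt (dot (w u0) (w u0)) != 0.
    by rewrite mulf_neq0 ?normr_eq0// sqrtr_eq0 -ltNge dot_gt0.
  exact: (cvgZ (cvgM lc (cvgV nz (cvgM (cvg_norm lc) sc))) wc).
have HW : \forall y \near x, W y by apply: open_nbhs_nbhs.
apply/cvgrPdist_lt => e e0; rewrite near_withinE.
move/cvgrPdist_lt: Gc => /(_ _ e0) Gc.
by apply: filterS2 HW Gc => y Wy Ge MBy; rewrite /from_subspace nux (nuE _ MBy Wy).1.
Qed.

End lighthouse_manifold.

Theorem theorem1p2 (R : realType) (n d : nat)
    (mu : {measure set (borel R n) -> \bar R}) (C : set 'rV[R]_n)
    (eps : R) (M B : set 'rV[R]_n)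
    (sigma : {measure set (borel R n) -> \bar R}) (rho : 'rV[R]_n -> R)
    (mu_lighthouse : lighthouse mu C)
    (eps01 : 0 < eps < 1)
    (M_submanifold : C1holder_submanifold d eps M)
    (sigma_volume : is_volume_measure d eps M sigma)
    (B_open : open B)
    (MB_nonempty : M `&` B !=set0)
    (rho_continuous : {within M `&` B, continuous rho})
    (rho_gt0 : forall x, (M `&` B) x -> 0 < rho x)
    (mu_density : forall A : set (borel R n), measurable A -> A `<=` B ->
      mu A = (\int[sigma]_(x in A `&` M) (rho x)%:E)%E) :
  n = d.+1 /\
  exists nu : 'rV[R]_n -> 'rV[R]_n,
    unit_normal_field (M `&` B) nu /\ forall x, (M `&` B) x -> C (nu x).
Proof.
have codim x (MBx : (M `&` B) x) := manifold_codim1 mu_lighthouse eps01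
  M_submanifold sigma_volume B_open rho_continuous rho_gt0 mu_density MBx.
split; first by have [x /codim] := MB_nonempty.
have normal x (MBx : (M `&` B) x) := unit_conormal mu_lighthouse eps01
  M_submanifold sigma_volume B_open rho_continuous rho_gt0 mu_density MBx.
pose N x := [set v | [/\ C v, dot v v = 1 & conormal M x v]].
(* An arbitrary choice will do, as [N x] determines its element on [M] and [B]; the default [0] is
   taken only where [N x] is empty. *)
pose nu x := xget 0 (N x).
have nuP x : (M `&` B) x -> N x (nu x).
  by move=> /normal[v vP]; exact: xgetPex (ex_intro _ v vP).
exists nu; split; last by move=> x /nuP[].
split; last first.
  move=> x /nuP[_ n1 Hx]; split => // v.
  by apply: conormal_tangent Hx; exact: subIsetl.
exact: (unit_conormal_continuous mu_lighthouse eps01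
  M_submanifold sigma_volume B_open rho_continuous rho_gt0 mu_density nuP).
Qed.
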